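(* Let $Y\subseteq\mathbb{R}^2$ be a finite union $$Y=\{g_1>0,\dots,g_m>0\}\cup\{g'_1>0,\dots,g'_{m'}>0\}\cup\dots\cup\{g''_1>0,\dots,g''_{m''}>0\},$$ where all the polynomials $g_j,g'_j,\dots,g''_j\in\mathbb{R}[x,y]$ are irreducible. Then there exists a cell decomposition $\mathcal{A}$ of $Y$ such that $(Y,\mathcal{A})$ is a CW complex and $\mathcal{A}$ has the finiteness property.
   Context: A cell decomposition of a set $X\subseteq\mathbb{R}^2$ is a partition of $X$ into (finitely or countably many) cells, each of which is a semi-algebraic set: 0-cells are points, 1-cells are subsets homeomorphic to an open interval, 2-cells are subsets homeomorphic to an open disk. A shortest-length curve in $X$ between two points $A,B\in X$ is a piecewise $C^2$ curve $\gamma$ from $A$ to $B$ lying entirely in $X$ whose length is minimal among all piecewise $C^2$ curves in $X$ from $A$ to $B$. A geodesic line segment (relative to the decomposition) is either a straight line segment or a connected arc contained (partially or entirely) in a 1-cell. A cell decomposition $\mathcal{A}$ of $X$ has the finiteness property if for every shortest-length curve $\gamma$ in $X$ between two points of $X$ and every cell $e\in\mathcal{A}$, the set $\gamma\cap e$ is either empty or has finitely many connected components, each of which is either a singleton or a geodesic line segment. *)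

(* Defs.v *)
From Stdlib Require Import Reals List.
From Coquelicot Require Import Coquelicot.
Open Scope R_scope.

Definition pt : Type := (R * R)%type.
Definition edist (p q : pt) : R :=
  sqrt ((fst p - fst q) ^ 2 + (snd p - snd q) ^ 2).

(** * Polynomials of R[x,y], represented by their polynomial functions
    (over the infinite field R, a polynomial is determined by its function). *)
Definition eval_monos (l : list (nat * nat * R)) (x y : R) : R :=
  fold_right (fun m acc => snd m * x ^ (fst (fst m)) * y ^ (snd (fst m)) + acc) 0 l.

Definition is_poly2 (f : R -> R -> R) : Prop :=
  exists l : list (nat * nat * R), forall x y, f x y = eval_monos l x y.

Definition const2 (f : R -> R -> R) : Prop := exists c, forall x y, f x y = c.

(** Irreducible element of R[x,y]: non-unit (= non-constant, since it is also
    nonzero), and any factorisation has a unit (= nonzero constant) factor. *)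
Definition irreducible2 (f : R -> R -> R) : Prop :=
  is_poly2 f /\ ~ const2 f /\
  forall p q, is_poly2 p -> is_poly2 q ->
    (forall x y, f x y = p x y * q x y) -> const2 p \/ const2 q.

Definition semialgebraic (S : pt -> Prop) : Prop :=
  exists blocks : list (list (R -> R -> R) * list (R -> R -> R)),
    (forall b, In b blocks ->
       (forall f, In f (fst b) -> is_poly2 f) /\ (forall h, In h (snd b) -> is_poly2 h)) /\
    forall p, S p <-> exists b, In b blocks /\
       (forall f, In f (fst b) -> f (fst p) (snd p) = 0) /\
       (forall h, In h (snd b) -> h (fst p) (snd p) > 0).

Definition cont_on (A : pt -> Prop) (f : pt -> pt) : Prop :=
  forall p, A p -> forall eps, eps > 0 -> exists del, del > 0 /\
    forall q, A q -> edist p q < del -> edist (f p) (f q) < eps.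

Definition homeomorphic (A B : pt -> Prop) : Prop :=
  exists (f g : pt -> pt),
    (forall p, A p -> B (f p) /\ g (f p) = p) /\
    (forall q, B q -> A (g q) /\ f (g q) = q) /\
    cont_on A f /\ cont_on B g.

Definition closure_in (X S : pt -> Prop) (p : pt) : Prop :=
  X p /\ forall eps, eps > 0 -> exists q, S q /\ edist p q < eps.

Definition closed_in (X S : pt -> Prop) : Prop :=
  forall p, closure_in X S p -> S p.

Definition open2 (U : pt -> Prop) : Prop :=
  forall p, U p -> exists eps, eps > 0 /\ forall q, edist p q < eps -> U q.

Definition connected2 (S : pt -> Prop) : Prop :=
  ~ exists U V, open2 U /\ open2 V /\
      (forall p, S p -> U p \/ V p) /\
      (exists p, S p /\ U p) /\ (exists p, S p /\ V p) /\
      (forall p, S p -> U p -> V p -> False).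

Definition component (S C : pt -> Prop) : Prop :=
  (forall p, C p -> S p) /\ (exists p, C p) /\ connected2 C /\
  forall D, (forall p, C p -> D p) -> (forall p, D p -> S p) -> connected2 D ->
    forall p, D p -> C p.

Definition open_model (n : nat) (p : pt) : Prop :=
  match n with
  | O => p = (0, 0)
  | 1%nat => snd p = 0 /\ -1 < fst p < 1
  | 2%nat => fst p ^ 2 + snd p ^ 2 < 1
  | _ => False
  end.

Definition closed_model (n : nat) (p : pt) : Prop :=
  match n with
  | O => p = (0, 0)
  | 1%nat => snd p = 0 /\ -1 <= fst p <= 1
  | 2%nat => fst p ^ 2 + snd p ^ 2 <= 1
  | _ => False
  end.

Definition is_ncell (n : nat) (e : pt -> Prop) : Prop :=
  (n <= 2)%nat /\ semialgebraic e /\ homeomorphic (open_model n) e.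

Definition is_cell (e : pt -> Prop) : Prop := exists n, is_ncell n e.

Definition cell_decomposition (X : pt -> Prop) (cA : (pt -> Prop) -> Prop) : Prop :=
  (exists enum : nat -> (pt -> Prop),
      forall e, cA e -> exists k, forall p, e p <-> enum k p) /\
  (forall e, cA e -> is_cell e) /\
  (forall e e', cA e -> cA e' -> (exists p, e p /\ e' p) -> forall p, e p <-> e' p) /\
  (forall p, X p <-> exists e, cA e /\ e p).

Definition CW_complex (X : pt -> Prop) (cA : (pt -> Prop) -> Prop) : Prop :=
  (forall e n, cA e -> is_ncell n e ->
     exists Phi psi : pt -> pt,
       cont_on (closed_model n) Phi /\
       (forall p, closed_model n p -> X (Phi p)) /\
       (forall p, open_model n p -> e (Phi p) /\ psi (Phi p) = p) /\
       (forall q, e q -> open_model n (psi q) /\ Phi (psi q) = q) /\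
       cont_on e psi /\
       (forall p, closed_model n p -> ~ open_model n p ->
          exists e' k, cA e' /\ is_ncell k e' /\ (k < n)%nat /\ e' (Phi p))) /\
  (forall e, cA e -> exists L : list (pt -> Prop),
     forall e', cA e' -> (exists p, closure_in X e p /\ e' p) ->
       exists e'', In e'' L /\ forall p, e' p <-> e'' p) /\
  (forall S, (forall p, S p -> X p) ->
     (forall e, cA e -> closed_in (closure_in X e) (fun p => S p /\ closure_in X e p)) ->
     closed_in X S).

Definition C2 (h : R -> R) : Prop :=
  forall t, ex_derive h t /\ ex_derive_n h 2 t /\ continuous (Derive_n h 2) t.

Definition pw_C2 (gam : R -> pt) : Prop :=
  exists (k : nat) (ts : nat -> R),
    (1 <= k)%nat /\ ts O = 0 /\ ts k = 1 /\
    (forall i, (i < k)%nat -> ts i < ts (S i)) /\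
    forall i, (i < k)%nat -> exists h1 h2 : R -> R, C2 h1 /\ C2 h2 /\
      forall t, ts i <= t <= ts (S i) -> gam t = (h1 t, h2 t).

Definition curve_in (X : pt -> Prop) (a b : pt) (gam : R -> pt) : Prop :=
  pw_C2 gam /\ gam 0 = a /\ gam 1 = b /\ forall t, 0 <= t <= 1 -> X (gam t).

Definition curve_length (gam : R -> pt) : R :=
  RInt (fun t => sqrt ((Derive (fun s => fst (gam s)) t) ^ 2 +
                       (Derive (fun s => snd (gam s)) t) ^ 2)) 0 1.

Definition shortest_curve (X : pt -> Prop) (a b : pt) (gam : R -> pt) : Prop :=
  curve_in X a b gam /\
  forall del, curve_in X a b del -> curve_length gam <= curve_length del.

Definition curve_set (gam : R -> pt) (p : pt) : Prop :=
  exists t, 0 <= t <= 1 /\ gam t = p.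

Definition seg_point (P Q : pt) (s : R) : pt :=
  ((1 - s) * fst P + s * fst Q, (1 - s) * snd P + s * snd Q).

Definition straight_segment (S : pt -> Prop) : Prop :=
  exists P Q, P <> Q /\
    (forall p, S p -> exists s, 0 <= s <= 1 /\ p = seg_point P Q s) /\
    (forall s, 0 < s < 1 -> S (seg_point P Q s)).

Definition geodesic_segment (cA : (pt -> Prop) -> Prop) (S : pt -> Prop) : Prop :=
  straight_segment S \/
  (connected2 S /\ (exists p q, S p /\ S q /\ p <> q) /\
   exists e', cA e' /\ is_ncell 1 e' /\ forall p, S p -> e' p).

Definition singleton2 (S : pt -> Prop) : Prop :=
  exists a, forall p, S p <-> p = a.

Definition finiteness_property (X : pt -> Prop) (cA : (pt -> Prop) -> Prop) : Prop :=
  forall a b gam e, shortest_curve X a b gam -> cA e ->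
    let G := fun p => curve_set gam p /\ e p in
    (exists L : list (pt -> Prop),
       forall C, component G C -> exists C', In C' L /\ forall p, C p <-> C' p) /\
    (forall C, component G C -> singleton2 C \/ geodesic_segment cA C).

Definition union_of_basic (Ys : list (list (R -> R -> R))) (p : pt) : Prop :=
  exists blk, In blk Ys /\ forall g, In g blk -> g (fst p) (snd p) > 0.

(* Main.v *)
Require Import Defs.
From Stdlib Require Import Reals List Lra Lia ZArith Classical Compare_dec PeanoNat.
From Stdlib Require Import FunctionalExtensionality PropExtensionality Cantor.
From Coquelicot Require Import Coquelicot.
Open Scope R_scope.

(** Only the openness of Y matters.  Decompose Y into cells of dyadic grids of
    varying mesh: a point p lies in its grid cell of level n, for the least n
    such that p keeps a sup-distance of about 3/2^n from the complement of Y.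
    This level is constant on the chosen cell, grows by at most one on passing
    to its boundary, and is locally bounded in Y, which gives the CW axioms; the
    characteristic map of a 2-cell is the radial homeomorphism from the disc to
    the square.  All cells are convex.  Shortest curves in an open set are
    straight segments, so they meet each cell in a convex subset of a line,
    which is connected. *)

(** * Shortest curves in open sets *)

(** The side of a coarse square may border on finer squares, yet a CW complex wants it covered by
    cells of smaller dimension. Hence the margin at a point is demanded around every grid cell whose
    closure contains the point: an edge or a vertex is then at least as fine as all cells around it,
    and the side of the coarse square is cut into pieces fine enough for both neighbours. For
    shortest curves the obstacle is the parametrisation, which may stand still and have corners, so
    there is no unit tangent to follow. Straightness comes from a maximum principle for linear forms
    instead. The CW axiom speaks of every [n] for which a cell is an n-cell, and this is a condition
    up to homeomorphism only. So invariance of dimension up to two has to be proved, the disc being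
    told from the interval by the intermediate value theorem. *)

Lemma edist_dist_euc p q : edist p q = dist_euc (fst p) (snd p) (fst q) (snd q).
Proof. unfold edist, dist_euc; rewrite !Rsqr_pow2; reflexivity. Qed.

Lemma edist_pos p q : 0 <= edist p q.
Proof. apply sqrt_pos. Qed.

Lemma edist_refl p : edist p p = 0.
Proof. rewrite edist_dist_euc; apply distance_refl. Qed.

Lemma edist_sym p q : edist p q = edist q p.
Proof. rewrite !edist_dist_euc; apply distance_symm. Qed.

Lemma edist_triangle p q r : edist p r <= edist p q + edist q r.
Proof. rewrite !edist_dist_euc; apply triangle. Qed.

Lemma edist_sqr p q :
  edist p q * edist p q = (fst p - fst q) ^ 2 + (snd p - snd q) ^ 2.
Proof. apply sqrt_sqrt, Rplus_le_le_0_compat; apply pow2_ge_0. Qed.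

Lemma Rabs_le_of_sqr u v d : 0 <= d -> d * d = u ^ 2 + v ^ 2 -> Rabs u <= d /\ Rabs v <= d.
Proof. intros; split; apply Rabs_le; split; nra. Qed.

Lemma edist_fst p q : Rabs (fst p - fst q) <= edist p q.
Proof.
  apply (Rabs_le_of_sqr _ _ _ (edist_pos p q) (edist_sqr p q)).
Qed.

Lemma edist_snd p q : Rabs (snd p - snd q) <= edist p q.
Proof.
  apply (Rabs_le_of_sqr _ _ _ (edist_pos p q) (edist_sqr p q)).
Qed.

Lemma edist_le_sum p q : edist p q <= Rabs (fst p - fst q) + Rabs (snd p - snd q).
Proof.
  pose proof (edist_sqr p q) as E; rewrite <- (pow2_abs (fst p - fst q)), <- (pow2_abs (snd p - snd q)) in E.
  revert E; generalize (edist_pos p q) (Rabs_pos (fst p - fst q)) (Rabs_pos (snd p - snd q)).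
  generalize (edist p q) (Rabs (fst p - fst q)) (Rabs (snd p - snd q)); intros; nra.
Qed.

Lemma edist_eq0 p q : edist p q = 0 -> p = q.
Proof.
  intros H; pose proof (edist_sqr p q) as E; rewrite H in E.
  destruct p as [a b], q as [c d]; simpl fst in E; simpl snd in E.
  pose proof (pow2_ge_0 (a - c)); pose proof (pow2_ge_0 (b - d)).
  f_equal; apply Rminus_diag_uniq, Rsqr_eq_0; rewrite Rsqr_pow2; lra.
Qed.

Lemma edist_pos_neq p q : p <> q -> 0 < edist p q.
Proof.
  intros H; destruct (edist_pos p q) as [|E]; auto.
  symmetry in E; now apply edist_eq0 in E.
Qed.

Lemma edist_seg_point P Q s u :
  edist (seg_point P Q s) (seg_point P Q u) = Rabs (s - u) * edist P Q.
Proof.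
  unfold edist, seg_point; simpl fst; simpl snd.
  rewrite <- (sqrt_pow2 (Rabs (s - u))) by apply Rabs_pos.
  rewrite pow2_abs, <- sqrt_mult by (try apply Rplus_le_le_0_compat; apply pow2_ge_0).
  f_equal; ring.
Qed.

Lemma seg_point_0 P Q : seg_point P Q 0 = P.
Proof. destruct P; unfold seg_point; simpl; f_equal; ring. Qed.

Lemma seg_point_1 P Q : seg_point P Q 1 = Q.
Proof. destruct Q; unfold seg_point; simpl; f_equal; ring. Qed.

Lemma cauchy_schwarz_unit al be x y d : al ^ 2 + be ^ 2 <= 1 ->
  0 <= d -> d * d = x ^ 2 + y ^ 2 -> al * x + be * y <= d.
Proof.
  intros H Hd E.
  (* Lagrange's identity: [(al x + be y)^2 + (al y - be x)^2 = (al^2 + be^2) (x^2 + y^2)]. *)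
  assert (0 <= (al * y - be * x) ^ 2) by apply pow2_ge_0.
  assert (0 <= (1 - al ^ 2 - be ^ 2) * (x ^ 2 + y ^ 2)) by (apply Rmult_le_pos; nra).
  nra.
Qed.

Lemma support_le_edist p q al be : al ^ 2 + be ^ 2 <= 1 ->
  al * (fst p - fst q) + be * (snd p - snd q) <= edist p q.
Proof.
  intros H; apply cauchy_schwarz_unit; [exact H | apply edist_pos | apply edist_sqr].
Qed.

(** Duality: the supremum of the forms of norm at most one is attained at the normalised difference
    vector. With [support_le_edist] this reduces convexity of the distance, and the comparison of
    chord and arc, to scalar linear inequalities. *)
Lemma edist_le_support p q L :
  (forall al be, al ^ 2 + be ^ 2 <= 1 ->
     al * (fst p - fst q) + be * (snd p - snd q) <= L) ->
  edist p q <= L.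
Proof.
  intros H; destruct (edist_pos p q) as [Hp|Hp].
  - pose proof (edist_sqr p q) as E.
    set (d := edist p q) in *.
    specialize (H ((fst p - fst q) / d) ((snd p - snd q) / d)).
    assert (E1 : ((fst p - fst q) / d) ^ 2 + ((snd p - snd q) / d) ^ 2 = 1).
    { transitivity (((fst p - fst q) ^ 2 + (snd p - snd q) ^ 2) / (d * d));
        [field; lra | rewrite <- E; field; lra]. }
    assert (E2 : (fst p - fst q) / d * (fst p - fst q)
                 + (snd p - snd q) / d * (snd p - snd q) = d).
    { transitivity (((fst p - fst q) ^ 2 + (snd p - snd q) ^ 2) / d);
        [field; lra | rewrite <- E; field; lra]. }
    rewrite <- E2; apply H; lra.
  - rewrite <- Hp; specialize (H 0 0); lra.
Qed.

(** * Piecewise C2 curves *)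

Definition smooth_piece (gam : R -> pt) (a b : R) : Prop :=
  exists h1 h2 : R -> R, C2 h1 /\ C2 h2 /\
    forall t, a <= t <= b -> gam t = (h1 t, h2 t).

(** Binary concatenation in place of an indexed list of breakpoints, so that restriction, gluing and
    length estimates are plain inductions. *)
Inductive pw (gam : R -> pt) : R -> R -> Prop :=
| pw_piece a b : a < b -> smooth_piece gam a b -> pw gam a b
| pw_cat a b c : pw gam a b -> pw gam b c -> pw gam a c.

Lemma pw_lt gam a b : pw gam a b -> a < b.
Proof. induction 1; lra. Qed.

Lemma smooth_piece_sub gam a b s t :
  a <= s -> t <= b -> smooth_piece gam a b -> smooth_piece gam s t.
Proof.
  intros Ha Hb (h1 & h2 & S1 & S2 & E); exists h1, h2; split; [exact S1|]; split; [exact S2|].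
  intros u Hu; apply E; lra.
Qed.

Lemma pw_sub gam a b : pw gam a b ->
  forall s t, a <= s -> s < t -> t <= b -> pw gam s t.
Proof.
  induction 1 as [a b Hab Hp | a b c H1 IH1 H2 IH2]; intros s t Hs Hst Ht.
  - apply pw_piece; auto. now apply smooth_piece_sub with a b.
  - destruct (Rle_lt_dec t b); [apply IH1; lra|].
    destruct (Rle_lt_dec b s); [apply IH2; lra|].
    apply pw_cat with b; [apply IH1 | apply IH2]; lra.
Qed.

Lemma pw_ext gam del a b : pw gam a b ->
  (forall t, a <= t <= b -> gam t = del t) -> pw del a b.
Proof.
  induction 1 as [a b Hab (h1 & h2 & S1 & S2 & E) | a b c H1 IH1 H2 IH2]; intros Heq.
  - apply pw_piece; auto. exists h1, h2; split; [exact S1|]; split; [exact S2|].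
    intros t Ht; rewrite <- Heq by lra; auto.
  - pose proof (pw_lt _ _ _ H1); pose proof (pw_lt _ _ _ H2).
    apply pw_cat with b; [apply IH1 | apply IH2]; intros; apply Heq; lra.
Qed.

Lemma pw_C2_pw gam : pw_C2 gam -> pw gam 0 1.
Proof.
  intros (k & ts & Hk & H0 & H1 & Hinc & Hp).
  assert (H : forall i, (i < k)%nat -> pw gam (ts O) (ts (S i))).
  { induction i as [|i IH]; intros Hi.
    - apply pw_piece; [now apply Hinc | now apply Hp].
    - apply pw_cat with (ts (S i)); [apply IH; lia|].
      apply pw_piece; [now apply Hinc | now apply Hp]. }
  specialize (H (pred k)); replace (S (pred k)) with k in H by lia.
  rewrite H0, H1 in H; apply H; lia.
Qed.

Lemma pw_subdivision gam a b : pw gam a b ->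
  exists (k : nat) (ts : nat -> R), (1 <= k)%nat /\ ts O = a /\ ts k = b /\
    (forall i, (i < k)%nat -> ts i < ts (S i)) /\
    forall i, (i < k)%nat -> smooth_piece gam (ts i) (ts (S i)).
Proof.
  induction 1 as [a b Hab Hp | a b c H1 (k & ts & K1 & K2 & K3 & K4 & K5)
                                     H2 (l & us & L1 & L2 & L3 & L4 & L5)].
  - exists 1%nat, (fun i => match i with O => a | _ => b end).
    repeat split; auto; intros [|i] Hi; try lia; auto.
  - exists (k + l)%nat, (fun i => if le_lt_dec i k then ts i else us (i - k)%nat).
    (* At index [k] both lists apply; they agree there, since the left one ends and the right one
       starts at [b]. *)
    assert (K : forall i, (k <= i)%nat ->
               (if le_lt_dec i k then ts i else us (i - k)%nat) = us (i - k)%nat).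
    { intros i Hi; destruct (le_lt_dec i k); auto.
      replace i with k by lia; rewrite Nat.sub_diag; congruence. }
    assert (K' : forall i, (i <= k)%nat ->
               (if le_lt_dec i k then ts i else us (i - k)%nat) = ts i).
    { intros i Hi; destruct (le_lt_dec i k); auto; lia. }
    repeat split; [lia | rewrite K' by lia; auto | rewrite K by lia;
      replace (k + l - k)%nat with l by lia; auto | |];
    intros i Hi; destruct (le_lt_dec k i).
    + rewrite !K by lia. replace (S i - k)%nat with (S (i - k)) by lia. apply L4; lia.
    + rewrite !K' by lia. apply K4; lia.
    + rewrite !K by lia. replace (S i - k)%nat with (S (i - k)) by lia. apply L5; lia.
    + rewrite !K' by lia. apply K5; lia.
Qed.

Lemma pw_pw_C2 gam : pw gam 0 1 -> pw_C2 gam.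
Proof.
  intros H; destruct (pw_subdivision _ _ _ H) as (k & ts & K); exists k, ts; exact K.
Qed.

(** * Speed and length *)

Definition speed (gam : R -> pt) (t : R) : R :=
  sqrt ((Derive (fun s => fst (gam s)) t) ^ 2 + (Derive (fun s => snd (gam s)) t) ^ 2).

(** Interior points only: at a breakpoint of a glued curve [Derive] may be an arbitrary default
    value, which the integral does not see. *)
Lemma speed_ext gam del a b t :
  a < t < b -> (forall s, a < s < b -> gam s = del s) -> speed gam t = speed del t.
Proof.
  intros Ht E; unfold speed.
  assert (L : locally t (fun s => gam s = del s)).
  { apply filter_imp with (fun s => a < s < b); auto.
    apply filter_and; [apply (open_gt a) | apply (open_lt b)]; apply Ht. }
  f_equal; f_equal; f_equal; apply Derive_ext_loc;
    apply filter_imp with (2 := L); now intros s ->.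
Qed.

Lemma C2_continuous_Derive h t : C2 h -> continuous (Derive h) t.
Proof.
  intros H; apply (ex_derive_continuous (V := R_NormedModule)).
  destruct (H t) as (_ & H2 & _); exact H2.
Qed.

Lemma continuous_speed h1 h2 t : C2 h1 -> C2 h2 ->
  continuous (speed (fun t => (h1 t, h2 t))) t.
Proof.
  intros H1 H2; unfold speed; simpl.
  apply continuous_comp with (g := sqrt).
  - apply (continuous_plus (V := R_NormedModule));
    (apply (continuous_mult (K := R_AbsRing)); [now apply C2_continuous_Derive|]);
    (apply (continuous_mult (K := R_AbsRing)); [now apply C2_continuous_Derive|]);
    apply continuous_const.
  - apply continuity_pt_filterlim, continuity_pt_sqrt; nra.
Qed.

(** Chord against arc: compose the curve with a linear form of norm at most one. The derivative of
    the composite is at most the speed by Cauchy-Schwarz, and integration gives the increment of the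
    form. *)
Lemma smooth_length h1 h2 s t : C2 h1 -> C2 h2 -> s <= t ->
  ex_RInt (speed (fun t => (h1 t, h2 t))) s t /\
  edist (h1 s, h2 s) (h1 t, h2 t) <= RInt (speed (fun t => (h1 t, h2 t))) s t.
Proof.
  intros H1 H2 Hst.
  assert (E : ex_RInt (speed (fun t => (h1 t, h2 t))) s t).
  { apply (ex_RInt_continuous (V := R_CompleteNormedModule)).
    intros; now apply continuous_speed. }
  split; auto.
  rewrite edist_sym; apply edist_le_support; intros al be Hn; simpl.
  assert (I : is_RInt (fun u => al * Derive h1 u + be * Derive h2 u) s t
                (minus (al * h1 t + be * h2 t) (al * h1 s + be * h2 s))).
  { apply (is_RInt_derive (fun u => al * h1 u + be * h2 u)).
    - intros u _. apply (is_derive_plus (fun u => al * h1 u) (fun u => be * h2 u));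
      apply is_derive_scal, Derive_correct; [apply H1 | apply H2].
    - intros u _. apply (continuous_plus (V := R_NormedModule));
      (apply (continuous_mult (K := R_AbsRing)); [apply continuous_const |
       now apply C2_continuous_Derive]). }
  replace (al * (h1 t - h1 s) + be * (h2 t - h2 s))
    with (minus (al * h1 t + be * h2 t) (al * h1 s + be * h2 s))
    by (unfold minus, plus, opp; simpl; ring).
  rewrite <- (is_RInt_unique _ _ _ _ I).
  apply RInt_le; auto; [eexists; exact I|].
  intros u _; unfold speed; simpl fst; simpl snd.
  set (x := Derive (fun s => h1 s) u); set (y := Derive (fun s => h2 s) u).
  change (Derive h1 u) with x; change (Derive h2 u) with y.
  apply cauchy_schwarz_unit; [exact Hn | apply sqrt_pos |].
  apply sqrt_sqrt, Rplus_le_le_0_compat; apply pow2_ge_0.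
Qed.

(** One induction serves all three conclusions: on a piece the Lipschitz constant is the maximum of
    the speed, and across a breakpoint integrals add up, chords obey the triangle inequality, and
    the larger constant serves both sides. *)
Lemma pw_length gam a b : pw gam a b ->
  exists K, 0 <= K /\ forall s t, a <= s -> s <= t -> t <= b ->
    ex_RInt (speed gam) s t /\
    edist (gam s) (gam t) <= RInt (speed gam) s t /\
    edist (gam s) (gam t) <= K * (t - s).
Proof.
  induction 1 as [a b Hab (h1 & h2 & S1 & S2 & E)
                 | a b c H1 (K1 & P1 & IH1) H2 (K2 & P2 & IH2)].
  - destruct (continuity_ab_maj (speed (fun t => (h1 t, h2 t))) a b) as (m & Hm & _).
    { lra. }
    { intros u _; apply continuity_pt_filterlim; now apply continuous_speed. }
    exists (speed (fun t => (h1 t, h2 t)) m); split; [apply sqrt_pos|].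
    intros s t Hs Hst Ht.
    destruct (smooth_length h1 h2 s t S1 S2 Hst) as [I D].
    assert (S : forall u, Rmin s t < u < Rmax s t ->
              speed (fun t => (h1 t, h2 t)) u = speed gam u).
    { rewrite Rmin_left, Rmax_right by lra; intros u Hu.
      apply speed_ext with s t; auto. intros v Hv; rewrite E by lra; auto. }
    rewrite !E by lra.
    rewrite <- (RInt_ext _ _ _ _ S).
    repeat split; auto.
    + now apply ex_RInt_ext with (1 := S).
    + eapply Rle_trans; [apply D|].
      eapply Rle_trans; [apply (RInt_le _ (fun _ => speed (fun t => (h1 t, h2 t)) m)); auto|].
      * apply ex_RInt_const.
      * intros u Hu; apply Hm; lra.
      * rewrite RInt_const; apply Req_le; unfold scal; simpl; unfold mult; simpl; ring.
  - exists (Rmax K1 K2); pose proof (Rmax_l K1 K2); pose proof (Rmax_r K1 K2).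
    split; [lra|].
    assert (A : forall s t, a <= s -> s <= t -> t <= b -> ex_RInt (speed gam) s t /\
       edist (gam s) (gam t) <= RInt (speed gam) s t /\
       edist (gam s) (gam t) <= (Rmax K1 K2) * (t - s)).
    { intros s t Hs Hst Ht. destruct (IH1 s t) as (? & ? & D); auto.
      repeat split; auto. apply Rle_trans with (1 := D), Rmult_le_compat_r; lra. }
    assert (B : forall s t, b <= s -> s <= t -> t <= c -> ex_RInt (speed gam) s t /\
       edist (gam s) (gam t) <= RInt (speed gam) s t /\
       edist (gam s) (gam t) <= (Rmax K1 K2) * (t - s)).
    { intros s t Hs Hst Ht. destruct (IH2 s t) as (? & ? & D); auto.
      repeat split; auto. apply Rle_trans with (1 := D), Rmult_le_compat_r; lra. }
    intros s t Hs Hst Ht.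
    destruct (Rle_lt_dec t b); [apply A; lra|].
    destruct (Rle_lt_dec b s); [apply B; lra|].
    destruct (A s b) as (A1 & A2 & A3); try lra.
    destruct (B b t) as (B1 & B2 & B3); try lra.
    pose proof (edist_triangle (gam s) (gam b) (gam t)).
    repeat split.
    + now apply ex_RInt_Chasles with b.
    + rewrite <- (RInt_Chasles _ s b t) by auto. unfold plus; simpl; lra.
    + lra.
Qed.

Lemma edist_seg_point_le c P Q s : 0 <= s <= 1 ->
  edist c (seg_point P Q s) <= (1 - s) * edist c P + s * edist c Q.
Proof.
  intros Hs; apply edist_le_support; intros al be H.
  pose proof (support_le_edist c P al be H); pose proof (support_le_edist c Q al be H).
  unfold seg_point; simpl fst; simpl snd.
  assert (0 <= (1 - s) * (edist c P - (al * (fst c - fst P) + be * (snd c - snd P))))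
    by (apply Rmult_le_pos; lra).
  assert (0 <= s * (edist c Q - (al * (fst c - fst Q) + be * (snd c - snd Q))))
    by (apply Rmult_le_pos; lra).
  lra.
Qed.

Lemma edist_seg_point_lt c P Q s r : 0 <= s <= 1 -> edist c P < r -> edist c Q < r ->
  edist c (seg_point P Q s) < r.
Proof.
  intros Hs HP HQ; eapply Rle_lt_trans; [now apply edist_seg_point_le|].
  (* One of the two weights is at least one half, hence positive, which keeps the inequality
     strict. *)
  destruct (Rle_lt_dec s (1/2)); nra.
Qed.

(** * Linear forms and first hitting times *)

Definition linear_form (al be : R) (p : pt) : R := al * fst p + be * snd p.

Lemma linear_form_lipschitz al be p q :
  Rabs (linear_form al be p - linear_form al be q) <= (Rabs al + Rabs be) * edist p q.
Proof.
  unfold linear_form.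
  replace (al * fst p + be * snd p - (al * fst q + be * snd q))
    with (al * (fst p - fst q) + be * (snd p - snd q)) by ring.
  eapply Rle_trans; [apply Rabs_triang|]; rewrite !Rabs_mult.
  pose proof (edist_fst p q); pose proof (edist_snd p q).
  pose proof (Rabs_pos al); pose proof (Rabs_pos be).
  rewrite Rmult_plus_distr_r; apply Rplus_le_compat; apply Rmult_le_compat_l; auto.
Qed.

(* Equality in the triangle inequality forces [c] onto the segment [p q]. *)
Lemma triangle_equality_eq al be p c q :
  edist p c + edist c q <= edist p q ->
  linear_form al be p < linear_form al be c ->
  linear_form al be q <= linear_form al be c -> c = q.
Proof.
  unfold linear_form; intros H Hp Hq.
  apply edist_eq0.
  generalize (edist_pos p c) (edist_pos c q) (edist_sqr p c) (edist_sqr c q) (edist_sqr p q).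
  replace (fst p - fst q) with ((fst p - fst c) + (fst c - fst q)) by ring.
  replace (snd p - snd q) with ((snd p - snd c) + (snd c - snd q)) by ring.
  assert (Hp' : al * (fst p - fst c) + be * (snd p - snd c) < 0) by lra.
  assert (Hq' : 0 <= al * (fst c - fst q) + be * (snd c - snd q)) by lra.
  revert H Hp' Hq'; generalize (edist p c) (edist c q) (edist p q).
  generalize (fst p - fst c) (snd p - snd c) (fst c - fst q) (snd c - snd q).
  clear; intros u1 u2 v1 v2 m n d H Hp Hq Hm Hn Em En Ed.
  assert (D : (m + n) * (m + n) <= d * d) by (apply Rmult_le_compat; lra).
  assert (I : m * n <= u1 * v1 + u2 * v2) by nra.
  destruct Hn as [Hn|]; auto; exfalso.
  assert (Hm' : 0 < m).
  { destruct Hm as [|E0]; auto; subst m; exfalso.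
    assert (u1 = 0) by (apply Rsqr_eq_0; unfold Rsqr; nra).
    assert (u2 = 0) by (apply Rsqr_eq_0; unfold Rsqr; nra). subst; lra. }
  (* Equality in Cauchy-Schwarz: the sum of squares equals [2 m n (m n - u.v)], which [I] makes
     nonpositive. So [n u = m v] with [m] and [n] positive, and the form would have the same sign on
     both vectors, against [Hp] and [Hq]. *)
  assert (Z : (n * u1 - m * v1) ^ 2 + (n * u2 - m * v2) ^ 2 <= 0).
  { replace ((n * u1 - m * v1) ^ 2 + (n * u2 - m * v2) ^ 2) with
      (n * n * (u1 ^ 2 + u2 ^ 2) + m * m * (v1 ^ 2 + v2 ^ 2) - 2 * (m * n) * (u1 * v1 + u2 * v2))
      by ring.
    rewrite <- Em, <- En.
    assert (0 <= 2 * (m * n) * (u1 * v1 + u2 * v2 - m * n)) by (apply Rmult_le_pos; nra).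
    nra. }
  pose proof (pow2_ge_0 (n * u1 - m * v1)); pose proof (pow2_ge_0 (n * u2 - m * v2)).
  assert (n * u1 - m * v1 = 0) by (apply Rsqr_eq_0; rewrite Rsqr_pow2; lra).
  assert (n * u2 - m * v2 = 0) by (apply Rsqr_eq_0; rewrite Rsqr_pow2; lra).
  assert (n * (al * u1 + be * u2) = m * (al * v1 + be * v2)).
  { replace (n * (al * u1 + be * u2)) with (al * (n * u1) + be * (n * u2)) by ring.
    replace (n * u1) with (m * v1) by lra. replace (n * u2) with (m * v2) by lra. ring. }
  assert (n * (al * u1 + be * u2) < 0) by nra.
  assert (0 <= m * (al * v1 + be * v2)) by (apply Rmult_le_pos; lra).
  lra.
Qed.

(** [T] is the supremum of the times up to which [f] stays below [v]. If [f T < v], then [f] would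
    stay below [v] a little longer; if [f T > v], it would have exceeded [v] a little earlier. That
    the hit is the first one supplies the strict inequality in [triangle_equality_eq]. *)
Lemma first_hit (f : R -> R) al be v K :
  (forall s t, al <= s <= be -> al <= t <= be -> Rabs (f s - f t) <= K * Rabs (s - t)) ->
  al <= be -> f al < v -> v <= f be ->
  exists t, al < t <= be /\ f t = v /\ forall u, al <= u < t -> f u < v.
Proof.
  intros L Hab Ha Hb.
  (* A positive Lipschitz constant, to divide by. *)
  assert (K0 : 0 < Rabs K + 1) by (pose proof (Rabs_pos K); lra).
  assert (L' : forall s t, al <= s <= be -> al <= t <= be ->
            Rabs (f s - f t) <= (Rabs K + 1) * Rabs (s - t)).
  { intros s t Hs Ht; eapply Rle_trans; [now apply L|].
    apply Rmult_le_compat_r; [apply Rabs_pos|]; pose proof (Rle_abs K); lra. }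
  clear L; revert K0 L'; generalize (Rabs K + 1); clear K; intros K K0 L.
  set (E := fun t => al <= t <= be /\ forall u, al <= u <= t -> f u < v).
  assert (Eal : E al).
  { split; [lra|]; intros u Hu; now replace u with al by lra. }
  destruct (completeness E) as (T & Tub & Tlub).
  { exists be; intros t [Ht _]; lra. }
  { now exists al. }
  assert (T1 : al <= T) by (now apply Tub).
  assert (T2 : T <= be) by (apply Tlub; intros t [Ht _]; lra).
  assert (B : forall u, al <= u < T -> f u < v).
  { intros u Hu; apply NNPP; intros N.
    assert (T <= u); [|lra]. apply Tlub; intros t [Ht Et].
    destruct (Rle_lt_dec t u); auto. exfalso; apply N, Et; lra. }
  assert (C : v <= f T).
  { apply Rnot_lt_le; intros N.
    (* Within time [d] the function moves by at most half of the gap [v - f T]. *)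
    set (d := Rmin (be - T) ((v - f T) / (2 * K))).
    assert (Hd : 0 < (v - f T) / (2 * K)) by (apply Rdiv_lt_0_compat; lra).
    assert (T < be) by (destruct T2; auto; subst; lra).
    assert (0 < d) by (apply Rmin_glb_lt; lra).
    assert (d1 : d <= be - T) by apply Rmin_l.
    assert (d2 : d <= (v - f T) / (2 * K)) by apply Rmin_r.
    assert (d3 : K * d <= (v - f T) / 2).
    { replace ((v - f T) / 2) with (K * ((v - f T) / (2 * K))) by (field; lra).
      apply Rmult_le_compat_l; lra. }
    assert (T + d <= T); [|lra]. apply Tub; split; [lra|]; intros u Hu.
    destruct (Rlt_le_dec u T); [apply B; lra|].
    assert (Lu := L u T ltac:(lra) ltac:(lra)).
    rewrite (Rabs_pos_eq (u - T)) in Lu by lra.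
    assert (K * (u - T) <= K * d) by (apply Rmult_le_compat_l; lra).
    pose proof (Rle_abs (f u - f T)); lra. }
  assert (T3 : al < T) by (destruct T1; auto; subst; lra).
  exists T; split; [lra|]; split; auto.
  apply Rle_antisym; auto. apply Rnot_lt_le; intros N.
  set (d := Rmin (T - al) ((f T - v) / (2 * K))).
  assert (Hd : 0 < (f T - v) / (2 * K)) by (apply Rdiv_lt_0_compat; lra).
  assert (0 < d) by (apply Rmin_glb_lt; lra).
  assert (d1 : d <= T - al) by apply Rmin_l.
  assert (d2 : d <= (f T - v) / (2 * K)) by apply Rmin_r.
  assert (d3 : K * d <= (f T - v) / 2).
  { replace ((f T - v) / 2) with (K * ((f T - v) / (2 * K))) by (field; lra).
    apply Rmult_le_compat_l; lra. }
  assert (Lu := L T (T - d) ltac:(lra) ltac:(lra)).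
  replace (T - (T - d)) with d in Lu by ring.
  rewrite (Rabs_pos_eq d) in Lu by lra.
  pose proof (Rle_abs (f T - f (T - d))).
  specialize (B (T - d)). lra.
Qed.

(** * Replacing an arc by its chord *)

Definition shortcut (gam : R -> pt) (s t : R) (u : R) : pt :=
  if Rle_dec u s then gam u else
  if Rle_dec t u then gam u else
  seg_point (gam s) (gam t) ((u - s) / (t - s)).

Lemma C2_affine a b : C2 (fun t => a + b * t).
Proof.
  intros t; repeat split.
  - auto_derive; auto.
  - apply ex_derive_ext with (fun _ => b).
    + intros u; symmetry; apply is_derive_unique; simpl. auto_derive; auto; ring.
    + apply ex_derive_const.
  - apply continuous_ext with (fun _ => 0); [|apply continuous_const].
    intros u; symmetry; simpl.
    transitivity (Derive (fun _ => b) u); [|apply Derive_const].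
    apply Derive_ext; intros w; apply is_derive_unique; auto_derive; auto; ring.
Qed.

Lemma seg_point_smooth P Q s t : s < t ->
  exists c1 d1 c2 d2, d1 ^ 2 + d2 ^ 2 = (edist P Q / (t - s)) ^ 2 /\
    forall u, seg_point P Q ((u - s) / (t - s)) = (c1 + d1 * u, c2 + d2 * u).
Proof.
  intros H.
  exists (fst P - s * (fst Q - fst P) / (t - s)), ((fst Q - fst P) / (t - s)),
         (snd P - s * (snd Q - snd P) / (t - s)), ((snd Q - snd P) / (t - s)).
  split.
  - transitivity (((fst P - fst Q) ^ 2 + (snd P - snd Q) ^ 2) / (t - s) ^ 2); [field; lra|].
    rewrite <- edist_sqr; field; lra.
  - intros u; unfold seg_point; f_equal; field; lra.
Qed.

Lemma speed_affine c1 d1 c2 d2 u :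
  speed (fun u => (c1 + d1 * u, c2 + d2 * u)) u = sqrt (d1 ^ 2 + d2 ^ 2).
Proof.
  unfold speed; simpl fst; simpl snd.
  assert (E : forall c d : R, Derive (fun s : R => c + d * s) u = d)
    by (intros; apply is_derive_unique; auto_derive; auto; ring).
  now rewrite !E.
Qed.

Lemma shortcut_left gam s t u : u <= s -> shortcut gam s t u = gam u.
Proof. unfold shortcut; destruct (Rle_dec u s); tauto. Qed.

Lemma shortcut_right gam s t u : t <= u -> shortcut gam s t u = gam u.
Proof. unfold shortcut; destruct (Rle_dec u s), (Rle_dec t u); tauto. Qed.

Lemma shortcut_mid gam s t u : s < t -> s <= u <= t ->
  shortcut gam s t u = seg_point (gam s) (gam t) ((u - s) / (t - s)).
Proof.
  intros H Hu; unfold shortcut; destruct (Rle_dec u s).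
  - replace u with s by lra. replace ((s - s) / (t - s)) with 0 by (field; lra).
    now rewrite seg_point_0.
  - destruct (Rle_dec t u); auto.
    replace u with t by lra. replace ((t - s) / (t - s)) with 1 by (field; lra).
    now rewrite seg_point_1.
Qed.

(** The curve with the arc over [[s, t]] replaced by its chord is a competitor of equal length
    elsewhere. So the arc is no longer than its chord, while it is at least as long as the two
    chords through [gam u]. The strict bounds on [s] and [t] keep all three pieces nondegenerate. *)
Lemma shortest_curve_shortcut Y a b gam s u t :
  shortest_curve Y a b gam -> 0 < s -> s < u -> u < t -> t < 1 ->
  (forall l, 0 <= l <= 1 -> Y (seg_point (gam s) (gam t) l)) ->
  edist (gam s) (gam u) + edist (gam u) (gam t) <= edist (gam s) (gam t).
Proof.
  intros [(G1 & G2 & G3 & G4) Gmin] Hs Hsu Hut Ht Hseg.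
  apply pw_C2_pw in G1.
  destruct (pw_length _ _ _ G1) as (K & _ & HK).
  set (del := shortcut gam s t).
  destruct (seg_point_smooth (gam s) (gam t) s t) as (c1 & d1 & c2 & d2 & Ed & Es); [lra|].
  assert (Dl : forall v, v <= s -> del v = gam v) by (intros; now apply shortcut_left).
  assert (Dr : forall v, t <= v -> del v = gam v) by (intros; now apply shortcut_right).
  assert (Dm : forall v, s <= v <= t -> del v = (c1 + d1 * v, c2 + d2 * v)).
  { intros; rewrite <- Es; apply shortcut_mid; lra. }
  assert (P : pw del 0 1).
  { apply pw_cat with s; [|apply pw_cat with t].
    - apply pw_ext with gam; [apply pw_sub with 0 1; auto; lra|].
      intros; symmetry; apply Dl; lra.
    - apply pw_piece; [lra|].
      exists (fun v => c1 + d1 * v), (fun v => c2 + d2 * v).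
      split; [apply C2_affine|]; split; [apply C2_affine|]; auto.
    - apply pw_ext with gam; [apply pw_sub with 0 1; auto; lra|].
      intros; symmetry; apply Dr; lra. }
  destruct (pw_length _ _ _ P) as (K' & _ & HK').
  assert (curve_in Y a b del) as Hdel.
  { split; [now apply pw_pw_C2|]. split; [rewrite Dl by lra; auto|].
    split; [rewrite Dr by lra; auto|].
    intros v Hv. destruct (Rle_lt_dec v s); [rewrite Dl by lra; apply G4; lra|].
    destruct (Rle_lt_dec t v); [rewrite Dr by lra; apply G4; lra|].
    unfold del; rewrite shortcut_mid by lra. apply Hseg; split.
    - apply Rcomplements.Rdiv_le_0_compat; lra.
    - apply Rmult_le_reg_r with (t - s); [lra|].
      unfold Rdiv; rewrite Rmult_assoc, Rinv_l; lra. }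
  apply Gmin in Hdel.
  change (RInt (speed gam) 0 1 <= RInt (speed del) 0 1) in Hdel.
  assert (S0 : RInt (speed gam) 0 s = RInt (speed del) 0 s).
  { apply RInt_ext; rewrite Rmin_left, Rmax_right by lra; intros v Hv.
    apply speed_ext with 0 s; auto; intros; symmetry; apply Dl; lra. }
  assert (S1 : RInt (speed gam) t 1 = RInt (speed del) t 1).
  { apply RInt_ext; rewrite Rmin_left, Rmax_right by lra; intros v Hv.
    apply speed_ext with t 1; auto; intros; symmetry; apply Dr; lra. }
  assert (Sm : RInt (speed del) s t = edist (gam s) (gam t)).
  { rewrite (RInt_ext _ (fun _ => edist (gam s) (gam t) / (t - s))).
    - rewrite RInt_const; unfold scal; simpl; unfold mult; simpl; field; lra.
    - rewrite Rmin_left, Rmax_right by lra; intros v Hv.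
      rewrite (speed_ext del (fun v => (c1 + d1 * v, c2 + d2 * v)) s t) by
        (auto; intros; apply Dm; lra).
      rewrite speed_affine, Ed; apply sqrt_pow2.
      apply Rcomplements.Rdiv_le_0_compat; [apply edist_pos | lra]. }
  assert (Ch : forall g, (forall x y, 0 <= x -> x <= y -> y <= 1 -> ex_RInt (speed g) x y) ->
    RInt (speed g) 0 1 = RInt (speed g) 0 s + RInt (speed g) s t + RInt (speed g) t 1).
  { intros g Hg. rewrite <- (RInt_Chasles (speed g) 0 t 1) by (apply Hg; lra).
    rewrite <- (RInt_Chasles (speed g) 0 s t) by (apply Hg; lra). reflexivity. }
  rewrite (Ch gam), (Ch del) in Hdel.
  2: { intros x y; apply HK'. }
  2: { intros x y; apply HK. }
  destruct (HK s u) as (I1 & I2 & _); try lra.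
  destruct (HK u t) as (J1 & J2 & _); try lra.
  rewrite <- (RInt_Chasles (speed gam) s u t) in Hdel by auto.
  unfold plus in Hdel; simpl in Hdel. lra.
Qed.

(** * The maximum principle and straightness of shortest curves *)

Definition clamp (t : R) : R := Rmax 0 (Rmin 1 t).

Lemma clamp_range t : 0 <= clamp t <= 1.
Proof. unfold clamp, Rmax, Rmin; repeat destruct Rle_dec; lra. Qed.

Lemma clamp_id t : 0 <= t <= 1 -> clamp t = t.
Proof. intros H; unfold clamp, Rmax, Rmin; repeat destruct Rle_dec; lra. Qed.

Lemma clamp_lipschitz s t :
  Rabs (clamp s - clamp t) <= Rabs (s - t).
Proof.
  unfold clamp, Rmax, Rmin; repeat destruct Rle_dec; unfold Rabs; repeat destruct Rcase_abs; lra.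
Qed.

Lemma lipschitz_max (f : R -> R) K :
  (forall s t, 0 <= s <= 1 -> 0 <= t <= 1 -> Rabs (f s - f t) <= K * Rabs (s - t)) ->
  exists m, 0 <= m <= 1 /\ forall t, 0 <= t <= 1 -> f t <= f m.
Proof.
  intros L.
  (* Continuity is asked on both sides of 0 and 1; [clamp] extends [f] to the line without enlarging
     the Lipschitz constant. *)
  destruct (continuity_ab_maj (fun t => f (clamp t)) 0 1) as (m & Hm & Hm1); [lra| |].
  - intros x _ eps Heps; exists (eps / (Rabs K + 1)).
    pose proof (Rabs_pos K); pose proof (Rle_abs K).
    split; [apply Rdiv_lt_0_compat; lra|].
    intros y [_ Hy]; simpl in *; unfold Rdist in *.
    eapply Rle_lt_trans; [apply L; apply clamp_range|].
    pose proof (clamp_lipschitz y x).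
    pose proof (Rabs_pos (clamp y - clamp x)).
    apply Rle_lt_trans with ((Rabs K + 1) * Rabs (y - x)).
    + apply Rle_trans with ((Rabs K + 1) * Rabs (clamp y - clamp x)).
      * apply Rmult_le_compat_r; lra.
      * apply Rmult_le_compat_l; lra.
    + replace eps with ((Rabs K + 1) * (eps / (Rabs K + 1))) by (field; lra).
      apply Rmult_lt_compat_l; lra.
  - exists m; split; auto; intros t Ht.
    rewrite <- (clamp_id t), <- (clamp_id m) by auto. now apply Hm.
Qed.

Lemma pw_lipschitz gam a b : pw gam a b ->
  exists K, 0 <= K /\ forall s t, a <= s <= b -> a <= t <= b ->
    edist (gam s) (gam t) <= K * Rabs (s - t).
Proof.
  intros H; destruct (pw_length _ _ _ H) as (K & HK0 & HK); exists K; split; auto.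
  intros s t Hs Ht; destruct (Rle_lt_dec s t).
  - rewrite Rabs_minus_sym, Rabs_pos_eq by lra. apply HK; lra.
  - rewrite edist_sym, Rabs_pos_eq by lra. apply HK; lra.
Qed.

(* A linear form cannot have an interior maximum on a shortest curve: just after
   first reaching the maximum, at a point [c], shortcuts show that the curve
   stays at [c], and it can never leave. *)
Lemma shortest_curve_maximum Y a b gam al be t :
  open2 Y -> shortest_curve Y a b gam -> 0 <= t <= 1 ->
  linear_form al be (gam t) <= Rmax (linear_form al be a) (linear_form al be b).
Proof.
  intros HY HS Ht; apply Rnot_lt_le; intros Hlt.
  pose proof HS as [(G1 & G2 & G3 & G4) _].
  destruct (pw_lipschitz _ _ _ (pw_C2_pw _ G1)) as (K & HK0 & HK).
  assert (L : forall s t, 0 <= s <= 1 -> 0 <= t <= 1 ->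
    Rabs (linear_form al be (gam s) - linear_form al be (gam t))
      <= (Rabs al + Rabs be) * K * Rabs (s - t)).
  { intros u v Hu Hv; eapply Rle_trans; [apply linear_form_lipschitz|].
    rewrite Rmult_assoc; apply Rmult_le_compat_l; auto.
    pose proof (Rabs_pos al); pose proof (Rabs_pos be); lra. }
  destruct (lipschitz_max _ _ L) as (m & Hm & Hmax).
  pose proof (Hmax t Ht) as Hmt.
  pose proof (Rmax_l (linear_form al be a) (linear_form al be b)).
  pose proof (Rmax_r (linear_form al be a) (linear_form al be b)).
  destruct (first_hit (fun t => linear_form al be (gam t)) 0 m
              (linear_form al be (gam m)) ((Rabs al + Rabs be) * K)) as (t0 & Ht0 & E0 & B0).
  { intros; apply L; lra. }
  { lra. }
  { rewrite G2; lra. }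
  { lra. }
  assert (t0 < 1).
  { destruct (Req_dec t0 1); [|lra]. subst t0; rewrite G3 in E0; lra. }
  set (c := gam t0) in *.
  assert (Yc : Y c) by (apply G4; lra).
  destruct (HY c Yc) as (r & Hr & Br).
  assert (Hd1 : 0 < edist c (gam 1)).
  { apply edist_pos_neq; intros Ec; rewrite Ec, G3 in E0; lra. }
  (* The curve must still reach this distance from [c] after [t0], because its endpoint is farther
     away; and the point where it does lies in the disc of radius [r], which is contained in [Y]. *)
  set (v := Rmin r (edist c (gam 1)) / 2).
  assert (0 < Rmin r (edist c (gam 1))) by (apply Rmin_glb_lt; auto).
  pose proof (Rmin_l r (edist c (gam 1))); pose proof (Rmin_r r (edist c (gam 1))).
  destruct (first_hit (fun t => edist c (gam t)) t0 1 v K) as (t2 & Ht2 & E2 & B2).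
  { intros u w Hu Hw. eapply Rle_trans; [|apply HK; lra].
    pose proof (edist_triangle c (gam u) (gam w)); pose proof (edist_triangle c (gam w) (gam u)).
    rewrite (edist_sym (gam w)) in *. apply Rabs_le; lra. }
  { lra. }
  { unfold c; rewrite edist_refl; unfold v; lra. }
  { unfold v; lra. }
  assert (t2 < 1).
  { destruct (Req_dec t2 1); [|lra]. subst t2; unfold v in E2; lra. }
  (* A time just before [t0]: still positive, and with [gam s] in the disc by the Lipschitz bound.
     The 1 in [K + 1] guards against division by zero. *)
  set (s := t0 - Rmin (t0 / 2) (r / (2 * (K + 1)))).
  assert (0 < r / (2 * (K + 1))) by (apply Rdiv_lt_0_compat; lra).
  assert (0 < Rmin (t0 / 2) (r / (2 * (K + 1)))) by (apply Rmin_glb_lt; lra).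
  pose proof (Rmin_l (t0 / 2) (r / (2 * (K + 1)))).
  pose proof (Rmin_r (t0 / 2) (r / (2 * (K + 1)))).
  assert (Hs : edist c (gam s) < r).
  { eapply Rle_lt_trans; [apply HK; unfold s; lra|].
    unfold s; replace (t0 - (t0 - Rmin (t0 / 2) (r / (2 * (K + 1)))))
      with (Rmin (t0 / 2) (r / (2 * (K + 1)))) by ring.
    rewrite Rabs_pos_eq by lra.
    apply Rle_lt_trans with (K * (r / (2 * (K + 1)))); [apply Rmult_le_compat_l; lra|].
    apply Rlt_trans with ((K + 1) * (r / (2 * (K + 1)))); [apply Rmult_lt_compat_r; lra|].
    replace ((K + 1) * (r / (2 * (K + 1)))) with (r / 2) by (field; lra). lra. }
  assert (Q : c = gam t2).
  (* The chord from [gam s] to [gam t2] stays in the disc, so the shortcut inequality holds at [c].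
     The form is below its maximum at [s], as [t0] is the first maximum, and does not exceed it at
     [t2]. Then [c = gam t2], although their distance is [v > 0]. *)
  { apply (triangle_equality_eq al be (gam s)).
    - apply (shortest_curve_shortcut Y a b); auto; try (unfold s; lra); try lra.
      intros l Hl; apply Br, edist_seg_point_lt; auto. unfold v in E2; lra.
    - change (gam t0) with c in E0; rewrite E0; apply B0; unfold s; lra.
    - change (gam t0) with c in E0; rewrite E0; apply Hmax; lra. }
  rewrite <- Q, edist_refl in E2. unfold v in E2; lra.
Qed.

Lemma on_line_param u1 u2 x y l : 0 < u1 ^ 2 + u2 ^ 2 ->
  u1 * y - u2 * x = 0 -> u1 * x + u2 * y = l * (u1 ^ 2 + u2 ^ 2) -> x = l * u1 /\ y = l * u2.
Proof.
  intros HD Hp Ha; split; apply Rmult_eq_reg_l with (u1 ^ 2 + u2 ^ 2); try lra.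
  - transitivity (u1 * (u1 * x + u2 * y) - u2 * (u1 * y - u2 * x)); [ring|].
    rewrite Hp, Ha; ring.
  - transitivity (u2 * (u1 * x + u2 * y) + u1 * (u1 * y - u2 * x)); [ring|].
    rewrite Hp, Ha; ring.
Qed.

(** The maximum principle bounds a form and its negative. The form normal to the chord has equal
    values at both ends, hence is constant and keeps the curve on the line; the form along the chord
    keeps it between the ends and, by the intermediate value property, takes every value in between,
    so no point of the segment is missed. *)
Lemma shortest_curve_segment Y a b gam : open2 Y -> shortest_curve Y a b gam ->
  forall p, curve_set gam p <-> exists l, 0 <= l <= 1 /\ p = seg_point a b l.
Proof.
  intros HY HS.
  assert (Mx : forall al be t, 0 <= t <= 1 ->
    linear_form al be (gam t) <= Rmax (linear_form al be a) (linear_form al be b))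
    by (intros; now apply (shortest_curve_maximum Y)).
  assert (Mi : forall al be t, 0 <= t <= 1 ->
    Rmin (linear_form al be a) (linear_form al be b) <= linear_form al be (gam t)).
  { intros al be t Ht; pose proof (Mx (- al) (- be) t Ht) as M.
    assert (N : forall p, linear_form (- al) (- be) p = - linear_form al be p)
      by (intros; unfold linear_form; ring).
    rewrite !N in M. revert M; unfold Rmax, Rmin; repeat destruct Rle_dec; lra. }
  pose proof HS as [(G1 & G2 & G3 & G4) _].
  destruct (classic (a = b)) as [<-|Hab].
  { assert (C : forall t, 0 <= t <= 1 -> gam t = a).
    { intros t Ht.
      pose proof (Mx 1 0 t Ht) as M1; pose proof (Mi 1 0 t Ht) as M2.
      pose proof (Mx 0 1 t Ht) as M3; pose proof (Mi 0 1 t Ht) as M4.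
      rewrite Rmax_left in M1, M3 by lra; rewrite Rmin_left in M2, M4 by lra.
      unfold linear_form in *.
      destruct a, (gam t); simpl in *; f_equal; lra. }
    assert (S : forall l, seg_point a a l = a).
    { intros l; destruct a; unfold seg_point; simpl; f_equal; ring. }
    intros p; split.
    - intros (t & Ht & <-); exists 0; rewrite S; split; auto; lra.
    - intros (l & Hl & ->); exists 0; rewrite S; split; auto; lra. }
  set (u1 := fst b - fst a); set (u2 := snd b - snd a).
  assert (HD : 0 < u1 ^ 2 + u2 ^ 2).
  { pose proof (edist_pos_neq _ _ Hab); pose proof (edist_sqr a b) as E.
    unfold u1, u2.
    replace ((fst b - fst a) ^ 2 + (snd b - snd a) ^ 2)
      with ((fst a - fst b) ^ 2 + (snd a - snd b) ^ 2) by ring.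
    rewrite <- E; now apply Rmult_lt_0_compat. }
  assert (Eb : linear_form u1 u2 b = linear_form u1 u2 a + (u1 ^ 2 + u2 ^ 2))
    by (unfold linear_form, u1, u2; ring).
  assert (P : forall t l, 0 <= t <= 1 ->
    linear_form u1 u2 (gam t) = linear_form u1 u2 a + l * (u1 ^ 2 + u2 ^ 2) ->
    gam t = seg_point a b l).
  { intros t l Ht El.
    pose proof (Mx (- u2) u1 t Ht) as M1; pose proof (Mi (- u2) u1 t Ht) as M2.
    assert (E : linear_form (- u2) u1 b = linear_form (- u2) u1 a)
      by (unfold linear_form, u1, u2; ring).
    rewrite E, Rmax_left in M1 by lra; rewrite E, Rmin_left in M2 by lra.
    destruct (on_line_param u1 u2 (fst (gam t) - fst a) (snd (gam t) - snd a) l HD) as [X1 X2].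
    - unfold linear_form in *; lra.
    - unfold linear_form in *; lra.
    - unfold seg_point; rewrite (surjective_pairing (gam t)); unfold u1, u2 in *; f_equal; lra. }
  intros p; split.
  - intros (t & Ht & <-).
    set (l := (linear_form u1 u2 (gam t) - linear_form u1 u2 a) / (u1 ^ 2 + u2 ^ 2)).
    assert (El : l * (u1 ^ 2 + u2 ^ 2) = linear_form u1 u2 (gam t) - linear_form u1 u2 a)
      by (unfold l; field; lra).
    exists l; split; [|apply P; auto; lra].
    pose proof (Mx u1 u2 t Ht) as M1; pose proof (Mi u1 u2 t Ht) as M2.
    rewrite Rmax_right in M1 by lra; rewrite Rmin_left in M2 by lra.
    split; apply Rmult_le_reg_r with (1 := HD); lra.
  - intros (l & Hl & ->).
    destruct (Req_dec l 0) as [->|Hl0].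
    { exists 0; rewrite seg_point_0; split; auto; lra. }
    destruct (pw_lipschitz _ _ _ (pw_C2_pw _ G1)) as (K & HK0 & HK).
    assert (0 < l * (u1 ^ 2 + u2 ^ 2)) by (apply Rmult_lt_0_compat; lra).
    assert (l * (u1 ^ 2 + u2 ^ 2) <= 1 * (u1 ^ 2 + u2 ^ 2)) by (apply Rmult_le_compat_r; lra).
    destruct (first_hit (fun t => linear_form u1 u2 (gam t)) 0 1
       (linear_form u1 u2 a + l * (u1 ^ 2 + u2 ^ 2)) ((Rabs u1 + Rabs u2) * K))
      as (t & Ht & Et & _).
    + intros u v Hu Hv; eapply Rle_trans; [apply linear_form_lipschitz|].
      rewrite Rmult_assoc; apply Rmult_le_compat_l; auto.
      pose proof (Rabs_pos u1); pose proof (Rabs_pos u2); lra.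
    + lra.
    + rewrite G2; lra.
    + rewrite G3, Eb; lra.
    + exists t; split; [lra|]; apply P; auto; lra.
Qed.

(** * Convex sets and the finiteness property *)

Definition convex2 (S : pt -> Prop) : Prop :=
  forall p q l, S p -> S q -> 0 <= l <= 1 -> S (seg_point p q l).

Lemma seg_point_seg_point a b l m s :
  seg_point (seg_point a b l) (seg_point a b m) s = seg_point a b ((1 - s) * l + s * m).
Proof. unfold seg_point; simpl; f_equal; ring. Qed.

Lemma open2_on_segment U p q t : open2 U -> U (seg_point p q t) ->
  exists d, 0 < d /\ forall s, Rabs (t - s) < d -> U (seg_point p q s).
Proof.
  intros HU Ht; destruct (HU _ Ht) as (r & Hr & B).
  pose proof (edist_pos p q).
  exists (r / (edist p q + 1)); split; [apply Rdiv_lt_0_compat; lra|].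
  intros s Hs; apply B; rewrite edist_seg_point.
  apply Rle_lt_trans with (Rabs (t - s) * (edist p q + 1)).
  - apply Rmult_le_compat_l; [apply Rabs_pos | lra].
  - replace r with (r / (edist p q + 1) * (edist p q + 1)) by (field; lra).
    apply Rmult_lt_compat_r; lra.
Qed.

(** On a segment from [U] to [V] let [T] be the supremum of the parameters in [U]. If the point at
    [T] is in [U], openness of [U] continues past [T]; if it is in [V], openness of [V] keeps [U]
    away from [T]. *)
Lemma convex2_connected2 S : convex2 S -> connected2 S.
Proof.
  intros HS (U & V & HU & HV & Cov & (p & Sp & Up) & (q & Sq & Vq) & Dis).
  set (E := fun t => 0 <= t <= 1 /\ U (seg_point p q t)).
  destruct (completeness E) as (T & Tub & Tlub).
  { exists 1; intros t [Ht _]; lra. }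
  { exists 0; split; [lra | now rewrite seg_point_0]. }
  assert (T1 : 0 <= T) by (apply Tub; split; [lra | now rewrite seg_point_0]).
  assert (T2 : T <= 1) by (apply Tlub; intros t [Ht _]; lra).
  assert (S1 : forall t, 0 <= t <= 1 -> S (seg_point p q t)) by (intros; now apply HS).
  destruct (Cov (seg_point p q T)) as [HT|HT]; [now apply S1| |].
  - destruct (open2_on_segment U p q T HU HT) as (d & Hd & B).
    assert (T < 1).
    { destruct T2 as [|E1]; auto; exfalso; rewrite E1, seg_point_1 in HT.
      now apply (Dis q). }
    set (d' := Rmin (d / 2) (1 - T)).
    assert (0 < d') by (apply Rmin_glb_lt; lra).
    assert (d' <= d / 2) by apply Rmin_l. assert (d' <= 1 - T) by apply Rmin_r.
    assert (T + d' <= T); [|lra].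
    apply Tub; split; [lra|]; apply B. rewrite Rabs_minus_sym, Rabs_pos_eq; lra.
  - destruct (open2_on_segment V p q T HV HT) as (d & Hd & B).
    assert (T <= T - d); [|lra].
    apply Tlub; intros t [Ht Ut].
    destruct (Rle_lt_dec t (T - d)); auto; exfalso.
    assert (t <= T) by (apply Tub; now split).
    apply (Dis (seg_point p q t)); auto. apply B; rewrite Rabs_pos_eq; lra.
Qed.

(** The parameters of the points of [G] form an interval, possibly without its ends;
    [straight_segment] allows for that by asking only for the open segment. *)
Lemma convex2_in_segment G a b : convex2 G ->
  (forall p, G p -> exists l, 0 <= l <= 1 /\ p = seg_point a b l) ->
  (exists p q, G p /\ G q /\ p <> q) -> straight_segment G.
Proof.
  intros HG Hab (p & q & Gp & Gq & Hpq).
  assert (Dist : forall l m, l <> m -> seg_point a b l <> seg_point a b m).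
  { intros l m Hlm E. apply Hpq.
    destruct (Hab p Gp) as (l1 & _ & ->); destruct (Hab q Gq) as (m1 & _ & ->).
    pose proof (edist_seg_point a b l m) as D; rewrite E, edist_refl in D.
    symmetry in D; apply Rmult_integral in D; destruct D as [D|D].
    - apply Rabs_eq_0 in D; lra.
    - apply edist_eq0; rewrite edist_seg_point, D; ring. }
  set (E := fun l => 0 <= l <= 1 /\ G (seg_point a b l)).
  (* Reflection, so that [completeness] also yields the infimum of [E], which is [- B]. *)
  set (E' := fun l => E (- l)).
  destruct (Hab p Gp) as (l1 & Hl1 & Ep); destruct (Hab q Gq) as (m1 & Hm1 & Eq).
  assert (E1 : E l1) by (split; [lra | now rewrite <- Ep]).
  assert (E2 : E m1) by (split; [lra | now rewrite <- Eq]).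
  destruct (completeness E) as (T & Tub & Tlub).
  { exists 1; intros t [Ht _]; lra. }
  { now exists l1. }
  destruct (completeness E') as (B & Bub & Blub).
  { exists 0; intros t [Ht _]; lra. }
  { exists (- l1); unfold E'; now rewrite Ropp_involutive. }
  assert (Lo : forall l, E l -> - B <= l).
  { intros l Hl; assert (- l <= B); [|lra]. apply Bub; unfold E'; now rewrite Ropp_involutive. }
  assert (l1 <> m1) by (intros D; apply Hpq; congruence).
  assert (BT : - B < T).
  { pose proof (Lo _ E1); pose proof (Lo _ E2); pose proof (Tub _ E1); pose proof (Tub _ E2).
    destruct (Rlt_le_dec l1 m1); lra. }
  exists (seg_point a b (- B)), (seg_point a b T); split; [|split].
  - apply Dist; lra.
  - intros r Gr; destruct (Hab r Gr) as (l & Hl & ->).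
    assert (El : E l) by (split; auto).
    pose proof (Lo _ El); pose proof (Tub _ El).
    exists ((l + B) / (T + B)); split.
    + split; [apply Rcomplements.Rdiv_le_0_compat; lra|].
      apply Rmult_le_reg_r with (T + B); [lra|].
      unfold Rdiv; rewrite Rmult_assoc, Rinv_l; lra.
    + rewrite seg_point_seg_point; f_equal; field; lra.
  - intros s Hs; rewrite seg_point_seg_point; set (l := (1 - s) * - B + s * T).
    assert (L1 : - B < l) by (unfold l; nra).
    assert (L2 : l < T) by (unfold l; nra).
    (* The extreme parameters need not belong to [E]; strictly between them there are parameters of
       [E] on both sides of [l]. *)
    assert (exists x, E x /\ x < l) as (x & Ex & Hx).
    { apply NNPP; intros N. assert (B <= - l); [|lra]. apply Blub; intros t Ht.
      destruct (Rle_lt_dec t (- l)); auto; exfalso; apply N; exists (- t); split; auto; lra. }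
    assert (exists y, E y /\ l < y) as (y & Ey & Hy).
    { apply NNPP; intros N. assert (T <= l); [|lra]. apply Tlub; intros t Ht.
      destruct (Rle_lt_dec t l); auto; exfalso; apply N; now exists t. }
    replace l with ((1 - (l - x) / (y - x)) * x + (l - x) / (y - x) * y) by (field; lra).
    rewrite <- seg_point_seg_point; apply HG; [apply Ex | apply Ey |].
    split; [apply Rcomplements.Rdiv_le_0_compat; lra|].
    apply Rmult_le_reg_r with (y - x); [lra|].
    unfold Rdiv; rewrite Rmult_assoc, Rinv_l; lra.
Qed.

Lemma component_connected2 G C : connected2 G -> component G C -> forall p, G p <-> C p.
Proof.
  intros HG (C1 & _ & _ & C4) p; split; [|apply C1].
  now apply (C4 G).
Qed.

Lemma finiteness_property_convex X cA : open2 X -> (forall e, cA e -> convex2 e) ->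
  finiteness_property X cA.
Proof.
  intros HX Hc a b gam e HS He G.
  pose proof (shortest_curve_segment X a b gam HX HS) as Seg.
  assert (GS : forall p, G p -> exists l, 0 <= l <= 1 /\ p = seg_point a b l)
    by (intros p [Hp _]; now apply Seg).
  assert (HG : convex2 G).
  { intros p q l [P1 P2] [Q1 Q2] Hl; split; [|now apply (Hc e He)].
    apply Seg in P1; apply Seg in Q1.
    destruct P1 as (x & Hx & ->), Q1 as (y & Hy & ->).
    apply Seg; exists ((1 - l) * x + l * y); rewrite seg_point_seg_point; split; auto; nra. }
  pose proof (fun C => component_connected2 G C (convex2_connected2 G HG)) as Comp.
  split.
  - exists (G :: nil); intros C HC; exists G; split; [now left|].
    intros p; symmetry; now apply Comp.
  - intros C HC; pose proof (Comp C HC) as E.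
    destruct (classic (exists p q, C p /\ C q /\ p <> q)) as [(p & q & Cp & Cq & Hpq)|N].
    + right; left.
      destruct (convex2_in_segment G a b HG GS) as (P & Q & PQ & S1 & S2).
      { exists p, q; rewrite !E; auto. }
      exists P, Q; split; auto; split.
      * intros r Hr; apply S1; now apply E.
      * intros s Hs; apply E; auto.
    + left; destruct HC as (_ & (p & Cp) & _).
      exists p; intros q; split; [|now intros ->].
      intros Cq; apply NNPP; intros D; apply N; exists q, p; auto.
Qed.

(** * Cells and characteristic maps *)

Lemma cont_on_subset (A B : pt -> Prop) f :
  (forall p, A p -> B p) -> cont_on B f -> cont_on A f.
Proof.
  intros AB H p Hp eps He; destruct (H p (AB p Hp) eps He) as (d & Hd & B1).
  exists d; split; auto.
Qed.

Lemma cont_on_comp (A B : pt -> Prop) f g :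
  (forall p, A p -> B (f p)) -> cont_on A f -> cont_on B g -> cont_on A (fun p => g (f p)).
Proof.
  intros AB Hf Hg p Hp eps He.
  destruct (Hg (f p) (AB p Hp) eps He) as (d & Hd & B1).
  destruct (Hf p Hp d Hd) as (d' & Hd' & B2).
  exists d'; split; auto.
Qed.

Lemma cont_on_continuity_2d (A : pt -> Prop) (f1 f2 : R -> R -> R) :
  (forall p, A p -> continuity_2d_pt f1 (fst p) (snd p) /\
                    continuity_2d_pt f2 (fst p) (snd p)) ->
  cont_on A (fun p => (f1 (fst p) (snd p), f2 (fst p) (snd p))).
Proof.
  intros H p Hp eps He; destruct (H p Hp) as [C1 C2].
  assert (He2 : 0 < eps / 2) by lra.
  destruct (C1 (mkposreal _ He2)) as (d1 & B1), (C2 (mkposreal _ He2)) as (d2 & B2).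
  exists (Rmin d1 d2); split; [apply Rmin_glb_lt; apply cond_pos|].
  intros q _ Hq; pose proof (Rmin_l d1 d2); pose proof (Rmin_r d1 d2).
  pose proof (edist_fst q p); pose proof (edist_snd q p); rewrite (edist_sym q p) in *.
  eapply Rle_lt_trans; [apply edist_le_sum|]; simpl fst; simpl snd.
  rewrite (Rabs_minus_sym (f1 _ _)), (Rabs_minus_sym (f2 _ _)).
  assert (Rabs (f1 (fst q) (snd q) - f1 (fst p) (snd p)) < eps / 2) by (apply B1; lra).
  assert (Rabs (f2 (fst q) (snd q) - f2 (fst p) (snd p)) < eps / 2) by (apply B2; lra).
  lra.
Qed.

(** * Homeomorphisms and invariance of dimension *)

Lemma homeomorphic_sym A B : homeomorphic A B -> homeomorphic B A.
Proof. intros (f & g & H1 & H2 & H3 & H4); exists g, f; auto. Qed.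

Lemma homeomorphic_trans A B C : homeomorphic A B -> homeomorphic B C -> homeomorphic A C.
Proof.
  intros (f & g & F1 & F2 & F3 & F4) (h & k & H1 & H2 & H3 & H4).
  exists (fun p => h (f p)), (fun p => g (k p)); repeat split.
  - now apply H1, F1.
  - destruct (F1 p H) as [Bp E]. destruct (H1 _ Bp) as [_ ->]; auto.
  - now apply F2, H2.
  - destruct (H2 q H) as [Bp E]. destruct (F2 _ Bp) as [_ ->]; auto.
  - apply cont_on_comp with B; auto. intros p Hp; now apply F1.
  - apply cont_on_comp with B; auto. intros p Hp; now apply H2.
Qed.

Lemma ivt_on_segment (D : pt -> Prop) (f : pt -> R) p r y : convex2 D ->
  (forall a, D a -> forall eps, 0 < eps -> exists del, 0 < del /\
     forall b, D b -> edist a b < del -> Rabs (f a - f b) < eps) ->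
  D p -> D r -> Rmin (f p) (f r) <= y <= Rmax (f p) (f r) ->
  exists s, 0 <= s <= 1 /\ f (seg_point p r s) = y.
Proof.
  intros HD Hf Hp Hr Hy.
  destruct (IVT_gen (fun s => f (seg_point p r (clamp s))) 0 1 y) as (s & Hs & E).
  - intros s eps He.
    assert (Ds : forall u, D (seg_point p r (clamp u))) by (intros; apply HD; auto; apply clamp_range).
    destruct (Hf _ (Ds s) eps He) as (d & Hd & B).
    pose proof (edist_pos p r).
    exists (d / (edist p r + 1)); split; [apply Rdiv_lt_0_compat; lra|].
    intros u [_ Hu]; simpl in *; unfold Rdist in *.
    rewrite Rabs_minus_sym; apply B; auto. rewrite edist_seg_point.
    rewrite Rabs_minus_sym in Hu.
    pose proof (clamp_lipschitz s u) as L.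
    pose proof (Rabs_pos (s - u)).
    apply Rle_lt_trans with (Rabs (s - u) * (edist p r + 1)).
    + apply Rmult_le_compat; try lra; apply Rabs_pos.
    + replace d with (d / (edist p r + 1) * (edist p r + 1)) by (field; lra).
      apply Rmult_lt_compat_r; lra.
  - rewrite !clamp_id by lra. now rewrite seg_point_0, seg_point_1.
  - rewrite Rmin_left, Rmax_right in Hs by lra.
    exists s; split; auto. rewrite <- E, clamp_id; auto.
Qed.

(** Of the values at three vertices one lies between the other two. The intermediate value theorem
    takes it again on the opposite side, at a point other than the vertex, against injectivity. *)
Lemma no_continuous_injection_of_triangle (D : pt -> Prop) (f : pt -> R) p q r : convex2 D ->
  (forall a, D a -> forall eps, 0 < eps -> exists del, 0 < del /\
     forall b, D b -> edist a b < del -> Rabs (f a - f b) < eps) ->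
  (forall a b, D a -> D b -> f a = f b -> a = b) ->
  D p -> D q -> D r ->
  (forall s, q <> seg_point p r s) -> (forall s, p <> seg_point q r s) ->
  (forall s, r <> seg_point p q s) -> False.
Proof.
  intros HD Hf Inj Hp Hq Hr N1 N2 N3.
  assert (Core : forall x y z, D x -> D y -> D z -> (forall s, y <> seg_point x z s) ->
            Rmin (f x) (f z) <= f y <= Rmax (f x) (f z) -> False).
  { intros x y z Dx Dy Dz N B.
    destruct (ivt_on_segment D f x z (f y)) as (s & Hs & E); auto.
    apply (N s), Inj; auto. }
  destruct (Rle_dec (f p) (f q)), (Rle_dec (f q) (f r)), (Rle_dec (f p) (f r));
    try lra;
    ((apply (Core p q r); auto; unfold Rmin, Rmax; repeat destruct Rle_dec; lra) ||
     (apply (Core q p r); auto; unfold Rmin, Rmax; repeat destruct Rle_dec; lra) ||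
     (apply (Core p r q); auto; unfold Rmin, Rmax; repeat destruct Rle_dec; lra)).
Qed.

Lemma convex2_disc : convex2 (open_model 2).
Proof.
  intros p q l Hp Hq Hl.
  assert (Eq : forall p, open_model 2 p <-> edist (0, 0) p < 1).
  { intros x; pose proof (edist_pos (0, 0) x); pose proof (edist_sqr (0, 0) x) as E.
    simpl in *. split; intros; nra. }
  apply Eq; apply Eq in Hp; apply Eq in Hq. now apply edist_seg_point_lt.
Qed.

Lemma open_model_0_not_homeomorphic n : (1 <= n <= 2)%nat ->
  ~ homeomorphic (open_model 0) (open_model n).
Proof.
  intros Hn (f & g & _ & H & _).
  assert (A : open_model n (0, 0)) by (destruct n as [|[|[|]]]; simpl; try lia; lra).
  assert (B : open_model n (1/2, 0)) by (destruct n as [|[|[|]]]; simpl; try lia; lra).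
  destruct (H _ A) as [A1 A2], (H _ B) as [B1 B2]; simpl in A1, B1.
  rewrite A1 in A2; rewrite B1, A2 in B2. injection B2; lra.
Qed.

Lemma open_model_1_2_not_homeomorphic : ~ homeomorphic (open_model 1) (open_model 2).
Proof.
  intros (f & g & _ & H & _ & C).
  apply (no_continuous_injection_of_triangle (open_model 2) (fun p => fst (g p))
           (0, 0) (1/2, 0) (0, 1/2)).
  - apply convex2_disc.
  - intros a Ha eps He; destruct (C a Ha eps He) as (d & Hd & B); exists d; split; auto.
    intros b Hb Hab; eapply Rle_lt_trans; [apply edist_fst | now apply B].
  - intros a b Ha Hb E.
    destruct (H a Ha) as [[A1 _] A2], (H b Hb) as [[B1 _] B2].
    rewrite <- A2, <- B2; f_equal. rewrite (surjective_pairing (g a)), (surjective_pairing (g b)).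
    congruence.
  - simpl; lra.
  - simpl; lra.
  - simpl; lra.
  - intros s E; injection E; unfold seg_point; simpl; intros; lra.
  - intros s E; injection E; unfold seg_point; simpl; intros; lra.
  - intros s E; injection E; unfold seg_point; simpl; intros; lra.
Qed.

Lemma open_model_dim_unique n m : (n <= 2)%nat -> (m <= 2)%nat ->
  homeomorphic (open_model n) (open_model m) -> n = m.
Proof.
  assert (L : forall n m, (n < m <= 2)%nat -> ~ homeomorphic (open_model n) (open_model m)).
  { intros [|[|i]] j Hj; [apply open_model_0_not_homeomorphic; lia | |lia].
    replace j with 2%nat by lia; apply open_model_1_2_not_homeomorphic. }
  intros Hn Hm H; destruct (lt_eq_lt_dec n m) as [[N|]|N]; auto; exfalso.
  - now apply (L n m).
  - apply (L m n); auto. now apply homeomorphic_sym.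
Qed.

(** [CW_complex] asks for a characteristic map for every [n] with [is_ncell n e]; by this lemma only
    the dimension of the box occurs. *)
Lemma is_ncell_dim_unique n m e : is_ncell n e -> is_ncell m e -> n = m.
Proof.
  intros (Hn & _ & H1) (Hm & _ & H2); apply open_model_dim_unique; auto.
  apply homeomorphic_trans with e; auto. now apply homeomorphic_sym.
Qed.

(** * Radial homeomorphisms between unit balls *)

Definition gauge (f : R -> R -> R) : Prop :=
  (forall c x y, 0 <= c -> f (c * x) (c * y) = c * f x y) /\
  (forall x y, 0 <= f x y) /\ (forall x y, f x y = 0 -> x = 0 /\ y = 0) /\
  (forall x y, continuity_2d_pt f x y).

(** Each point slides along its ray until its [g]-value is its old [f]-value, so the unit ball of
    [f] goes onto that of [g]. At the origin the quotient divides by zero, but the factor 0 sends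
    the origin to itself. *)
Definition radial (f g : R -> R -> R) (p : pt) : pt :=
  (fst p * (f (fst p) (snd p) / g (fst p) (snd p)),
   snd p * (f (fst p) (snd p) / g (fst p) (snd p))).

Lemma gauge_0 f : gauge f -> f 0 0 = 0.
Proof.
  intros (H & _); specialize (H 0 0 0 (Rle_refl 0)); rewrite !Rmult_0_l in H; exact H.
Qed.

Lemma gauge_pos f x y : gauge f -> x <> 0 \/ y <> 0 -> 0 < f x y.
Proof.
  intros (_ & H1 & H2 & _) N; destruct (H1 x y) as [|E]; auto.
  symmetry in E; apply H2 in E; lra.
Qed.

Lemma radial_0 f g : radial f g (0, 0) = (0, 0).
Proof. unfold radial; simpl; f_equal; ring. Qed.

Lemma radial_gauge f g p : gauge f -> gauge g ->
  g (fst (radial f g p)) (snd (radial f g p)) = f (fst p) (snd p).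
Proof.
  intros Gf Gg; destruct p as [x y].
  destruct (classic (x <> 0 \/ y <> 0)) as [N|N].
  - pose proof (gauge_pos f x y Gf N); pose proof (gauge_pos g x y Gg N).
    unfold radial; simpl; rewrite !(Rmult_comm _ (_ / _)).
    destruct Gg as (Hg & _). rewrite Hg by (apply Rcomplements.Rdiv_le_0_compat; lra).
    field; lra.
  - assert (x = 0) by tauto; assert (y = 0) by tauto; subst.
    rewrite radial_0; simpl; rewrite !gauge_0; auto.
Qed.

Lemma radial_inv f g p : gauge f -> gauge g -> radial g f (radial f g p) = p.
Proof.
  intros Gf Gg; destruct p as [x y].
  destruct (classic (x <> 0 \/ y <> 0)) as [N|N].
  - pose proof (gauge_pos f x y Gf N); pose proof (gauge_pos g x y Gg N).
    unfold radial at 1; rewrite (radial_gauge f g (x, y)) by auto.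
    unfold radial; simpl; rewrite !(Rmult_comm _ (f x y / g x y)).
    destruct Gf as (Hf & _). rewrite Hf by (apply Rcomplements.Rdiv_le_0_compat; lra).
    f_equal; field; lra.
  - assert (x = 0) by tauto; assert (y = 0) by tauto; subst.
    now rewrite !radial_0.
Qed.

(** Away from the origin this is a quotient of continuous functions; at the origin the ratio [f / g]
    is merely bounded, and continuity is due to the factor [h], which vanishes there. *)
Lemma radial_coord_continuity f g (h : R -> R -> R) C : gauge f -> gauge g ->
  (forall x y, f x y <= C * g x y) -> (forall x y, continuity_2d_pt h x y) -> h 0 0 = 0 ->
  forall x y, continuity_2d_pt (fun x y => h x y * (f x y / g x y)) x y.
Proof.
  intros Gf Gg HC Hh Hh0 x y.
  destruct (classic (x <> 0 \/ y <> 0)) as [N|N].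
  - pose proof (gauge_pos g x y Gg N).
    apply continuity_2d_pt_mult; auto. unfold Rdiv.
    apply continuity_2d_pt_mult; [apply Gf|].
    apply continuity_2d_pt_inv; [apply Gg | lra].
  - assert (x = 0) by tauto; assert (y = 0) by tauto; subst.
    intros eps.
    assert (HC0 : 0 < Rabs C + 1) by (pose proof (Rabs_pos C); lra).
    assert (He : 0 < eps / (Rabs C + 1)) by (apply Rdiv_lt_0_compat; [apply cond_pos | lra]).
    destruct (Hh 0 0 (mkposreal _ He)) as (d & B); exists d; intros u v Hu Hv.
    specialize (B u v Hu Hv); simpl in B; rewrite Hh0, Rminus_0_r in B.
    rewrite Hh0, Rmult_0_l, Rminus_0_r.
    destruct (classic (u <> 0 \/ v <> 0)) as [N'|N'].
    + pose proof (gauge_pos f u v Gf N'); pose proof (gauge_pos g u v Gg N').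
      rewrite Rabs_mult, (Rabs_pos_eq (f u v / g u v))
        by (apply Rcomplements.Rdiv_le_0_compat; lra).
      assert (f u v / g u v <= Rabs C + 1).
      { apply Rmult_le_reg_r with (g u v); auto.
        unfold Rdiv; rewrite Rmult_assoc, Rinv_l, Rmult_1_r by lra.
        eapply Rle_trans; [apply HC|]. apply Rmult_le_compat_r; [lra|].
        pose proof (Rle_abs C); lra. }
      apply Rle_lt_trans with (Rabs (h u v) * (Rabs C + 1)).
      * apply Rmult_le_compat_l; auto; apply Rabs_pos.
      * replace (pos eps) with (eps / (Rabs C + 1) * (Rabs C + 1)) by (field; lra).
        apply Rmult_lt_compat_r; lra.
    + assert (u = 0) by tauto; assert (v = 0) by tauto; subst.
      rewrite Hh0, Rmult_0_l, Rabs_R0; apply cond_pos.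
Qed.

Lemma radial_cont f g C A : gauge f -> gauge g -> (forall x y, f x y <= C * g x y) ->
  cont_on A (radial f g).
Proof.
  intros Gf Gg HC; unfold radial.
  apply (cont_on_continuity_2d A (fun x y => x * (f x y / g x y)) (fun x y => y * (f x y / g x y))).
  intros p _; split.
  - apply (radial_coord_continuity f g (fun x _ => x) C); auto.
    intros; apply continuity_2d_pt_id1.
  - apply (radial_coord_continuity f g (fun _ y => y) C); auto.
    intros; apply continuity_2d_pt_id2.
Qed.

Definition euclid_norm (x y : R) : R := sqrt (x ^ 2 + y ^ 2).

(* This is [Rmax (Rabs x) (Rabs y)]. *)
Definition max_norm (x y : R) : R := (Rabs (x + y) + Rabs (x - y)) / 2.

Lemma euclid_norm_sqr x y : euclid_norm x y * euclid_norm x y = x ^ 2 + y ^ 2.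
Proof. apply sqrt_sqrt, Rplus_le_le_0_compat; apply pow2_ge_0. Qed.

Lemma continuity_2d_pt_pow f n x y : continuity_2d_pt f x y ->
  continuity_2d_pt (fun x y => f x y ^ n) x y.
Proof.
  intros H; induction n as [|n IH]; simpl.
  - apply continuity_2d_pt_const.
  - now apply continuity_2d_pt_mult.
Qed.

Lemma gauge_euclid : gauge euclid_norm.
Proof.
  repeat split.
  - intros c x y Hc; unfold euclid_norm.
    replace ((c * x) ^ 2 + (c * y) ^ 2) with (c ^ 2 * (x ^ 2 + y ^ 2)) by ring.
    rewrite sqrt_mult, sqrt_pow2; auto; [apply pow2_ge_0|].
    apply Rplus_le_le_0_compat; apply pow2_ge_0.
  - intros; apply sqrt_pos.
  - pose proof (euclid_norm_sqr x y) as E; rewrite H in E.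
    pose proof (pow2_ge_0 x); pose proof (pow2_ge_0 y).
    apply Rsqr_eq_0; rewrite Rsqr_pow2; lra.
  - pose proof (euclid_norm_sqr x y) as E; rewrite H in E.
    pose proof (pow2_ge_0 x); pose proof (pow2_ge_0 y).
    apply Rsqr_eq_0; rewrite Rsqr_pow2; lra.
  - intros x y; unfold euclid_norm. apply continuity_1d_2d_pt_comp.
    + apply continuity_pt_sqrt, Rplus_le_le_0_compat; apply pow2_ge_0.
    + apply continuity_2d_pt_plus; apply continuity_2d_pt_pow;
        [apply continuity_2d_pt_id1 | apply continuity_2d_pt_id2].
Qed.

Lemma gauge_max : gauge max_norm.
Proof.
  repeat split.
  - intros c x y Hc; unfold max_norm.
    rewrite <- Rmult_plus_distr_l, <- Rmult_minus_distr_l, !Rabs_mult, (Rabs_pos_eq c) by auto.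
    field.
  - intros x y; unfold max_norm; pose proof (Rabs_pos (x + y)); pose proof (Rabs_pos (x - y)); lra.
  - revert H; unfold max_norm, Rabs; repeat destruct Rcase_abs; lra.
  - revert H; unfold max_norm, Rabs; repeat destruct Rcase_abs; lra.
  - intros x y; unfold max_norm, Rdiv.
    apply continuity_2d_pt_mult; [|apply continuity_2d_pt_const].
    apply continuity_2d_pt_plus; apply continuity_1d_2d_pt_comp;
      try apply Rcontinuity_abs;
      [apply continuity_2d_pt_plus | apply continuity_2d_pt_minus];
      solve [apply continuity_2d_pt_id1 | apply continuity_2d_pt_id2].
Qed.

Lemma euclid_le_max x y : euclid_norm x y <= 2 * max_norm x y.
Proof.
  pose proof (euclid_norm_sqr x y) as E; pose proof (sqrt_pos (x ^ 2 + y ^ 2)) as H.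
  fold (euclid_norm x y) in H.
  (* The parallelogram identity expresses both norms through [|x + y|] and [|x - y|]. *)
  replace (x ^ 2 + y ^ 2) with (((x + y) ^ 2 + (x - y) ^ 2) / 2) in E by field.
  rewrite <- (pow2_abs (x + y)), <- (pow2_abs (x - y)) in E.
  unfold max_norm; pose proof (Rabs_pos (x + y)); pose proof (Rabs_pos (x - y)); nra.
Qed.

Lemma max_le_euclid x y : max_norm x y <= 1 * euclid_norm x y.
Proof.
  pose proof (euclid_norm_sqr x y) as E; pose proof (sqrt_pos (x ^ 2 + y ^ 2)) as H.
  fold (euclid_norm x y) in H.
  replace (x ^ 2 + y ^ 2) with (((x + y) ^ 2 + (x - y) ^ 2) / 2) in E by field.
  rewrite <- (pow2_abs (x + y)), <- (pow2_abs (x - y)) in E.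
  unfold max_norm; pose proof (Rabs_pos (x + y)); pose proof (Rabs_pos (x - y)).
  pose proof (pow2_ge_0 (Rabs (x + y) - Rabs (x - y))).
  nra.
Qed.

Lemma max_norm_lt x y r : max_norm x y < r <-> Rabs x < r /\ Rabs y < r.
Proof. unfold max_norm, Rabs; repeat destruct Rcase_abs; split; lra. Qed.

Lemma max_norm_le x y r : max_norm x y <= r <-> Rabs x <= r /\ Rabs y <= r.
Proof. unfold max_norm, Rabs; repeat destruct Rcase_abs; split; lra. Qed.

Lemma open_disc_euclid p : open_model 2 p <-> euclid_norm (fst p) (snd p) < 1.
Proof.
  simpl; pose proof (euclid_norm_sqr (fst p) (snd p)).
  pose proof (sqrt_pos (fst p ^ 2 + snd p ^ 2)) as P; fold (euclid_norm (fst p) (snd p)) in P.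
  split; nra.
Qed.

Lemma closed_disc_euclid p : closed_model 2 p <-> euclid_norm (fst p) (snd p) <= 1.
Proof.
  simpl; pose proof (euclid_norm_sqr (fst p) (snd p)).
  pose proof (sqrt_pos (fst p ^ 2 + snd p ^ 2)) as P; fold (euclid_norm (fst p) (snd p)) in P.
  split; nra.
Qed.

(* The relative interior of [a, a + s], which for [s = 0] is the point [a]. *)
Definition interval_cell (a s x : R) : Prop := a <= x <= a + s /\ (s = 0 \/ a < x < a + s).

Definition interval_dim (s : R) : nat := if Req_EM_T s 0 then 0%nat else 1%nat.

Definition box_cell (a s b t : R) (p : pt) : Prop :=
  interval_cell a s (fst p) /\ interval_cell b t (snd p).

Definition box (a s b t : R) (p : pt) : Prop :=
  a <= fst p <= a + s /\ b <= snd p <= b + t.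

(** [e] is the open cell and [K] the closed one. The last clause only says that the boundary sphere
    misses [e]; in which cells it lands depends on the levels and is settled later. *)
Definition characteristic_map (n : nat) (e K : pt -> Prop) (Phi psi : pt -> pt) : Prop :=
  cont_on (closed_model n) Phi /\
  (forall p, closed_model n p -> K (Phi p)) /\
  (forall p, open_model n p -> e (Phi p) /\ psi (Phi p) = p) /\
  (forall q, e q -> open_model n (psi q) /\ Phi (psi q) = q) /\
  cont_on e psi /\
  (forall p, closed_model n p -> ~ open_model n p -> ~ e (Phi p)).

Definition to_interval (a s u : R) : R := a + s * (1 + u) / 2.
Definition of_interval (a s x : R) : R := 2 * (x - a) / s - 1.

Lemma to_of_interval a s x : 0 < s -> to_interval a s (of_interval a s x) = x.
Proof. intros; unfold to_interval, of_interval; field; lra. Qed.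

Lemma of_to_interval a s u : 0 < s -> of_interval a s (to_interval a s u) = u.
Proof. intros; unfold to_interval, of_interval; field; lra. Qed.

Lemma to_interval_open a s u : 0 < s -> (interval_cell a s (to_interval a s u) <-> Rabs u < 1).
Proof.
  intros Hs; unfold interval_cell, to_interval; split.
  - intros [_ [|H]]; [lra|]. apply Rabs_def1; nra.
  - intros H; apply Rabs_def2 in H.
    assert (a < a + s * (1 + u) / 2 < a + s) by (split; nra). lra.
Qed.

Lemma to_interval_closed a s u : 0 < s -> Rabs u <= 1 ->
  a <= to_interval a s u <= a + s.
Proof.
  intros Hs H; unfold to_interval. pose proof (Rle_abs u); pose proof (Rle_abs (- u)).
  rewrite Rabs_Ropp in *. split; nra.
Qed.

Lemma of_interval_open a s x : 0 < s -> interval_cell a s x -> Rabs (of_interval a s x) < 1.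
Proof.
  intros Hs H; rewrite <- (to_interval_open a s) by auto. now rewrite to_of_interval.
Qed.

Lemma interval_cell_0 a x : interval_cell a 0 x <-> x = a.
Proof. unfold interval_cell; split; lra. Qed.

Ltac continuity_2d :=
  unfold to_interval, of_interval, Rdiv;
  repeat first [ apply continuity_2d_pt_const | apply continuity_2d_pt_id1
               | apply continuity_2d_pt_id2 | apply continuity_2d_pt_plus
               | apply continuity_2d_pt_minus | apply continuity_2d_pt_mult ].

(** * Characteristic maps of points, edges and rectangles *)

Lemma characteristic_map_0 a b :
  characteristic_map 0 (box_cell a 0 b 0) (box a 0 b 0) (fun _ => (a, b)) (fun _ => (0, 0)).
Proof.
  unfold characteristic_map, box_cell, box; simpl.
  repeat split; auto; try lra.
  - intros p _ eps He; exists 1; split; [lra|]; intros; now rewrite edist_refl.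
  - destruct H as [H1 H2]; apply interval_cell_0 in H1; apply interval_cell_0 in H2.
    rewrite (surjective_pairing q); congruence.
  - intros p _ eps He; exists 1; split; [lra|]; intros; now rewrite edist_refl.
Qed.

Lemma characteristic_map_h a s b : 0 < s ->
  characteristic_map 1 (box_cell a s b 0) (box a s b 0)
    (fun p => (to_interval a s (fst p), b)) (fun q => (of_interval a s (fst q), 0)).
Proof.
  intros Hs; split; [|split; [|split; [|split; [|split]]]].
  - apply (cont_on_continuity_2d _ (fun x y => to_interval a s x) (fun _ _ => b)).
    intros p _; split; continuity_2d.
  - intros p [_ Hp]; split; simpl; [|lra].
    apply to_interval_closed; auto; apply Rabs_le; auto.
  - intros p [H0 Hp]; split; [split|]; simpl.
    + apply to_interval_open; auto; apply Rabs_def1; lra.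
    + now apply interval_cell_0.
    + rewrite of_to_interval, <- H0 by auto; now destruct p.
  - intros q [H1 H2]; split; simpl.
    + apply of_interval_open, Rabs_def2 in H1; auto; split; lra.
    + apply interval_cell_0 in H2. rewrite to_of_interval, <- H2 by auto; now destruct q.
  - apply (cont_on_continuity_2d _ (fun x y => of_interval a s x) (fun _ _ => 0)).
    intros p _; split; continuity_2d.
  - intros p [Hp _] N [H1 _]; apply N; split; auto.
    apply to_interval_open, Rabs_def2 in H1; auto; split; lra.
Qed.

Lemma characteristic_map_v a b t : 0 < t ->
  characteristic_map 1 (box_cell a 0 b t) (box a 0 b t)
    (fun p => (a, to_interval b t (fst p))) (fun q => (of_interval b t (snd q), 0)).
Proof.
  intros Hs; split; [|split; [|split; [|split; [|split]]]].
  - apply (cont_on_continuity_2d _ (fun _ _ => a) (fun x y => to_interval b t x)).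
    intros p _; split; continuity_2d.
  - intros p [_ Hp]; split; simpl; [lra|].
    apply to_interval_closed; auto; apply Rabs_le; auto.
  - intros p [H0 Hp]; split; [split|]; simpl.
    + now apply interval_cell_0.
    + apply to_interval_open; auto; apply Rabs_def1; lra.
    + rewrite of_to_interval, <- H0 by auto; now destruct p.
  - intros q [H1 H2]; split; simpl.
    + apply of_interval_open, Rabs_def2 in H2; auto; split; lra.
    + apply interval_cell_0 in H1. rewrite to_of_interval, <- H1 by auto; now destruct q.
  - apply (cont_on_continuity_2d _ (fun x y => of_interval b t y) (fun _ _ => 0)).
    intros p _; split; continuity_2d.
  - intros p [Hp _] N [_ H1]; apply N; split; auto.
    apply to_interval_open, Rabs_def2 in H1; auto; split; lra.
Qed.

Lemma characteristic_map_2 a s b t : 0 < s -> 0 < t ->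
  exists Phi psi, characteristic_map 2 (box_cell a s b t) (box a s b t) Phi psi.
Proof.
  intros Hs Ht.
  (* [D] takes the disc to the square [[-1, 1]^2] and [A] takes the square to the box; [E] and [B]
     are their inverses. *)
  set (A := fun p : pt => (to_interval a s (fst p), to_interval b t (snd p))).
  set (B := fun p : pt => (of_interval a s (fst p), of_interval b t (snd p))).
  set (D := radial euclid_norm max_norm); set (E := radial max_norm euclid_norm).
  assert (AB : forall p, A (B p) = p).
  { intros [x y]; unfold A, B; simpl; now rewrite !to_of_interval. }
  assert (BA : forall p, B (A p) = p).
  { intros [x y]; unfold A, B; simpl; now rewrite !of_to_interval. }
  assert (DE : forall p, D (E p) = p) by (intros; apply radial_inv; [apply gauge_max | apply gauge_euclid]).
  assert (ED : forall p, E (D p) = p) by (intros; apply radial_inv; [apply gauge_euclid | apply gauge_max]).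
  assert (Ao : forall p, box_cell a s b t (A p) <-> max_norm (fst p) (snd p) < 1).
  { intros p; unfold box_cell, A; simpl. now rewrite !to_interval_open, max_norm_lt. }
  assert (Do : forall p, box_cell a s b t (A (D p)) <-> open_model 2 p).
  { intros p. rewrite Ao, open_disc_euclid. unfold D.
    rewrite radial_gauge; [tauto | apply gauge_euclid | apply gauge_max]. }
  exists (fun p => A (D p)), (fun p => E (B p)).
  split; [|split; [|split; [|split; [|split]]]].
  - apply cont_on_comp with (fun _ => True); auto.
    + apply radial_cont with 2; [apply gauge_euclid | apply gauge_max | apply euclid_le_max].
    + apply (cont_on_continuity_2d _ (fun x y => to_interval a s x) (fun x y => to_interval b t y)).
      intros p _; split; continuity_2d.
  - intros p Hp; apply closed_disc_euclid in Hp.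
    assert (Hm : max_norm (fst (D p)) (snd (D p)) <= 1).
    { unfold D; rewrite radial_gauge; auto; [apply gauge_euclid | apply gauge_max]. }
    apply max_norm_le in Hm; split; apply to_interval_closed; tauto.
  - intros p Hp; split; [now apply Do|]. now rewrite BA, ED.
  - intros q Hq; rewrite DE, AB; split; auto.
    apply Do. now rewrite DE, AB.
  - apply cont_on_comp with (fun _ => True); auto.
    + apply (cont_on_continuity_2d _ (fun x y => of_interval a s x) (fun x y => of_interval b t y)).
      intros p _; split; continuity_2d.
    + apply radial_cont with 1; [apply gauge_max | apply gauge_euclid | apply max_le_euclid].
  - intros p _ N H; apply N; now apply Do.
Qed.

Lemma box_characteristic_map a s b t : 0 <= s -> 0 <= t ->
  exists Phi psi, characteristic_map (interval_dim s + interval_dim t)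
                    (box_cell a s b t) (box a s b t) Phi psi.
Proof.
  intros Hs Ht; unfold interval_dim; destruct (Req_EM_T s 0) as [->|], (Req_EM_T t 0) as [->|].
  - eexists _, _; apply characteristic_map_0.
  - eexists _, _; apply characteristic_map_v; lra.
  - eexists _, _; apply characteristic_map_h; lra.
  - apply characteristic_map_2; lra.
Qed.

Lemma open_model_closed n p : open_model n p -> closed_model n p.
Proof. destruct n as [|[|[|]]]; simpl; auto; lra. Qed.

Lemma characteristic_map_homeomorphic n e K Phi psi :
  characteristic_map n e K Phi psi -> homeomorphic (open_model n) e.
Proof.
  intros (H1 & H2 & H3 & H4 & H5 & H6); exists Phi, psi; repeat split; try apply H3; try apply H4; auto.
  apply cont_on_subset with (2 := H1), open_model_closed.
Qed.

(** * Boxes are semi-algebraic convex cells *)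

Lemma is_poly2_affine c0 c1 c2 : is_poly2 (fun x y => c0 + c1 * x + c2 * y).
Proof.
  exists (((0, 0, c0) :: (1, 0, c1) :: (0, 1, c2) :: nil)%nat).
  intros x y; simpl; ring.
Qed.

Lemma is_poly2_ext f g : is_poly2 f -> (forall x y, g x y = f x y) -> is_poly2 g.
Proof. intros (l & H) E; exists l; intros; now rewrite E. Qed.

(** A pair [(c, d)] encodes the affine function [c + d x], so the same lists can later be read in
    either coordinate. *)
Lemma interval_cell_conditions a s : exists eqs ineqs : list (R * R),
  forall x, interval_cell a s x <->
    (forall c, In c eqs -> fst c + snd c * x = 0) /\
    (forall c, In c ineqs -> fst c + snd c * x > 0).
Proof.
  destruct (Req_dec s 0) as [->|Hs].
  - exists ((- a, 1) :: nil), nil; intros x; rewrite interval_cell_0; split.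
    + intros ->; split; [|now intros c []]. intros c [<-|[]]; simpl; ring.
    + intros [H _]; specialize (H _ (or_introl eq_refl)); simpl in H; lra.
  - exists nil, ((- a, 1) :: (a + s, -1) :: nil); intros x; unfold interval_cell; split.
    + intros [_ [|H]]; [lra|]; split; [now intros c []|].
      intros c [<-|[<-|[]]]; simpl; lra.
    + intros [_ H]; pose proof (H _ (or_introl eq_refl)) as H1.
      pose proof (H _ (or_intror (or_introl eq_refl))) as H2; simpl in H1, H2; lra.
Qed.

Lemma semialgebraic_box_cell a s b t : semialgebraic (box_cell a s b t).
Proof.
  destruct (interval_cell_conditions a s) as (e1 & i1 & H1).
  destruct (interval_cell_conditions b t) as (e2 & i2 & H2).
  set (X := map (fun c : R * R => fun x y : R => fst c + snd c * x)).
  set (Y := map (fun c : R * R => fun x y : R => fst c + snd c * y)).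
  assert (PX : forall l f, In f (X l) -> is_poly2 f).
  { intros l f Hf; apply in_map_iff in Hf; destruct Hf as (c & <- & _).
    apply is_poly2_ext with (1 := is_poly2_affine (fst c) (snd c) 0); intros; ring. }
  assert (PY : forall l f, In f (Y l) -> is_poly2 f).
  { intros l f Hf; apply in_map_iff in Hf; destruct Hf as (c & <- & _).
    apply is_poly2_ext with (1 := is_poly2_affine (fst c) 0 (snd c)); intros; ring. }
  exists ((X e1 ++ Y e2, X i1 ++ Y i2) :: nil); split.
  - intros bl [<-|[]]; simpl; split; intros f Hf; apply in_app_or in Hf; destruct Hf; eauto.
  - intros p; unfold box_cell; rewrite H1, H2; split.
    + intros [[A1 A2] [B1 B2]]; eexists; split; [now left|]; simpl; split; intros f Hf;
      apply in_app_or in Hf; destruct Hf as [Hf|Hf]; apply in_map_iff in Hf;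
      destruct Hf as (c & <- & Hc); auto.
    + intros (bl & [<-|[]] & A & B); simpl in A, B.
      repeat split; intros c Hc;
        [apply (A (fun x y => fst c + snd c * x)) | apply (B (fun x y => fst c + snd c * x))
        |apply (A (fun x y => fst c + snd c * y)) | apply (B (fun x y => fst c + snd c * y))];
        apply in_or_app; [left|left|right|right];
        apply in_map_iff; exists c; auto.
Qed.

Lemma is_ncell_box_cell a s b t : 0 <= s -> 0 <= t ->
  is_ncell (interval_dim s + interval_dim t) (box_cell a s b t).
Proof.
  intros Hs Ht; split; [|split].
  - unfold interval_dim; destruct Req_EM_T, Req_EM_T; lia.
  - apply semialgebraic_box_cell.
  - destruct (box_characteristic_map a s b t Hs Ht) as (Phi & psi & H).
    apply characteristic_map_homeomorphic with (1 := H).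
Qed.

Lemma interval_cell_convex a s x y l : interval_cell a s x -> interval_cell a s y ->
  0 <= l <= 1 -> interval_cell a s ((1 - l) * x + l * y).
Proof.
  intros [Hx Hx'] [Hy Hy'] Hl; split; [split; nra|].
  destruct Hx' as [|Hx']; auto; destruct Hy' as [|Hy']; auto; right.
  destruct (Rle_lt_dec l (1 / 2)); split; nra.
Qed.

Lemma box_cell_convex a s b t : convex2 (box_cell a s b t).
Proof.
  intros p q l [P1 P2] [Q1 Q2] Hl; split; now apply interval_cell_convex.
Qed.

(** * The dyadic decomposition of an open set *)

(* [y] lies in the closure of the cell of level [n] containing [x], where the
   cells of level [n] are the points of Z/2^n and the gaps between them. *)
Definition adherent (n : nat) (x y : R) : Prop :=
  forall k : Z, (IZR k <= x * 2 ^ n -> IZR k <= y * 2 ^ n) /\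
                (x * 2 ^ n <= IZR k -> y * 2 ^ n <= IZR k).

Definition dyadic (n : nat) (x : R) : Prop := exists k : Z, x * 2 ^ n = IZR k.

Definition cell_lo (n : nat) (x : R) : R := IZR (Int_part (x * 2 ^ n)) / 2 ^ n.
Definition cell_width (n : nat) (x : R) : R :=
  if Req_EM_T (x * 2 ^ n) (IZR (Int_part (x * 2 ^ n))) then 0 else / 2 ^ n.
Definition cell_dim (n : nat) (x : R) : nat := interval_dim (cell_width n x).

Lemma pow2_pos n : 0 < 2 ^ n.
Proof. apply pow_lt; lra. Qed.

Lemma adherent_refl n x : adherent n x x.
Proof. split; auto. Qed.

Lemma adherent_trans n x y z : adherent n x y -> adherent n y z -> adherent n x z.
Proof. intros H1 H2 k; split; intros; now apply H2, H1. Qed.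

(** The integer [k] of the coarse grid is the even integer [2 k] of the finer one, so the coarse
    conditions are among the fine ones. *)
Lemma adherent_S n x y : adherent (S n) x y -> adherent n x y.
Proof.
  intros H k; specialize (H (2 * k)%Z); rewrite mult_IZR in H; simpl in H; lra.
Qed.

Lemma adherent_le n m x y : (n <= m)%nat -> adherent m x y -> adherent n x y.
Proof. induction 1; auto. intros; now apply IHle, adherent_S. Qed.

Lemma int_part_spec r : IZR (Int_part r) <= r < IZR (Int_part r) + 1.
Proof. destruct (base_Int_part r); lra. Qed.

Lemma int_part_IZR r k : r = IZR k -> r = IZR (Int_part r).
Proof.
  intros E; pose proof (int_part_spec r) as H.
  assert (k = Int_part r); [|congruence].
  rewrite E in H at 2 3; destruct H as [H1 H2]. rewrite <- plus_IZR in H2.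
  apply le_IZR in H1; apply lt_IZR in H2; lia.
Qed.

Lemma cell_width_dyadic n x :
  (cell_width n x = 0 /\ dyadic n x) \/ (cell_width n x = / 2 ^ n /\ ~ dyadic n x).
Proof.
  unfold cell_width; destruct Req_EM_T as [E|E]; [left | right]; split; auto.
  - now exists (Int_part (x * 2 ^ n)).
  - intros (k & Hk); apply E. now apply int_part_IZR with k.
Qed.

Lemma cell_width_nonneg n x : 0 <= cell_width n x.
Proof.
  pose proof (Rinv_0_lt_compat _ (pow2_pos n)).
  destruct (cell_width_dyadic n x) as [[-> _]|[-> _]]; lra.
Qed.

Lemma cell_width_le n x : cell_width n x <= / 2 ^ n.
Proof.
  pose proof (Rinv_0_lt_compat _ (pow2_pos n)).
  destruct (cell_width_dyadic n x) as [[-> _]|[-> _]]; lra.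
Qed.

Lemma adherent_gap n x y k : IZR k < x * 2 ^ n < IZR k + 1 ->
  (adherent n x y <-> IZR k <= y * 2 ^ n <= IZR k + 1).
Proof.
  intros Hx; split.
  - intros H; pose proof (H k) as H1; pose proof (H (k + 1)%Z) as H2.
    rewrite plus_IZR in H2; lra.
  - intros Hy j; split; intros Hj.
    + assert (j < k + 1)%Z by (apply lt_IZR; rewrite plus_IZR; lra).
      apply Rle_trans with (IZR k); [apply IZR_le; lia | lra].
    + assert (k < j)%Z by (apply lt_IZR; lra).
      apply Rle_trans with (IZR (k + 1)); [rewrite plus_IZR; lra | apply IZR_le; lia].
Qed.

Lemma scale_le n x k : IZR k / 2 ^ n <= x <-> IZR k <= x * 2 ^ n.
Proof.
  pose proof (pow2_pos n); split; intros H1.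
  - apply Rmult_le_compat_r with (r := 2 ^ n) in H1; [|lra].
    unfold Rdiv in H1; rewrite Rmult_assoc, Rinv_l in H1; lra.
  - apply Rmult_le_reg_r with (2 ^ n); auto.
    unfold Rdiv; rewrite Rmult_assoc, Rinv_l; lra.
Qed.

Lemma scale_ge n x k : x <= IZR k / 2 ^ n <-> x * 2 ^ n <= IZR k.
Proof.
  pose proof (pow2_pos n); split; intros H1.
  - apply Rmult_le_compat_r with (r := 2 ^ n) in H1; [|lra].
    unfold Rdiv in H1; rewrite Rmult_assoc, Rinv_l in H1; lra.
  - apply Rmult_le_reg_r with (2 ^ n); auto.
    unfold Rdiv; rewrite Rmult_assoc, Rinv_l; lra.
Qed.

Lemma adherent_interval n x y :
  adherent n x y <-> cell_lo n x <= y <= cell_lo n x + cell_width n x.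
Proof.
  pose proof (int_part_spec (x * 2 ^ n)) as Hx.
  unfold cell_lo, cell_width; set (k := Int_part (x * 2 ^ n)) in *.
  destruct Req_EM_T as [E|E].
  - rewrite Rplus_0_r, scale_le, scale_ge; split.
    + intros H; specialize (H k); lra.
    + intros H j; lra.
  - replace (IZR k / 2 ^ n + / 2 ^ n) with (IZR (k + 1) / 2 ^ n)
      by (rewrite plus_IZR; pose proof (pow2_pos n); field; lra).
    rewrite scale_le, scale_ge, plus_IZR. apply adherent_gap; lra.
Qed.

Lemma adherent_dyadic n x y : dyadic n x -> adherent n x y -> x = y.
Proof.
  intros H Hy; apply adherent_interval in Hy.
  pose proof (proj1 (adherent_interval n x x) (adherent_refl n x)).
  destruct (cell_width_dyadic n x) as [[E _]|[_ N]]; [lra | contradiction].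
Qed.

Lemma dyadic_le n m x : (n <= m)%nat -> dyadic n x -> dyadic m x.
Proof.
  induction 1; auto. intros D; destruct (IHle D) as (k & Hk).
  exists (2 * k)%Z; rewrite mult_IZR, <- Hk; simpl; ring.
Qed.

(** Mutual adherence is the equivalence relation whose classes are the cells: an endpoint of a gap
    adheres to the gap, but the gap does not adhere to the endpoint. *)
Lemma adherent_sym_interval n x y :
  (adherent n x y /\ adherent n y x) <-> interval_cell (cell_lo n x) (cell_width n x) y.
Proof.
  pose proof (pow2_pos n).
  unfold interval_cell; rewrite <- adherent_interval.
  destruct (cell_width_dyadic n x) as [[E D]|[E D]].
  - rewrite E; split.
    + tauto.
    + intros [Hy _]; split; auto. now rewrite (adherent_dyadic n x y D Hy); apply adherent_refl.
  - pose proof (int_part_spec (x * 2 ^ n)) as Hx.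
    assert (Hx' : IZR (Int_part (x * 2 ^ n)) < x * 2 ^ n).
    { destruct Hx as [[|E1] _]; auto; exfalso; apply D; eexists; symmetry; exact E1. }
    rewrite E; unfold cell_lo; set (k := Int_part (x * 2 ^ n)) in *.
    replace (IZR k / 2 ^ n + / 2 ^ n) with (IZR (k + 1) / 2 ^ n)
      by (rewrite plus_IZR; field; lra).
    split.
    + intros [A1 A2]; split; auto; right.
      split; apply Rnot_le_lt; intros N; [apply scale_ge in N | apply scale_le in N].
      * specialize (A2 k); lra.
      * rewrite plus_IZR in N; specialize (A2 (k + 1)%Z); rewrite plus_IZR in A2; lra.
    + intros [A1 [B|[B1 B2]]].
      * pose proof (Rinv_0_lt_compat _ H); lra.
      * split; auto. apply (adherent_gap n y x k); [|lra].
        assert (N1 : ~ y * 2 ^ n <= IZR k) by (rewrite <- scale_ge; lra).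
        assert (N2 : ~ IZR (k + 1) <= y * 2 ^ n) by (rewrite <- scale_le; lra).
        rewrite plus_IZR in N2; lra.
Qed.

Lemma adherent_dist n x y : adherent n x y -> Rabs (x - y) <= / 2 ^ n.
Proof.
  intros H; apply adherent_interval in H.
  pose proof (proj1 (adherent_interval n x x) (adherent_refl n x)).
  pose proof (cell_width_le n x). apply Rabs_le; lra.
Qed.

(** A point of the closed cell outside the open one is an end of a gap, hence dyadic of level [n]
    and of every finer level, so its dimension is 0 also at level [m]. The alternative is stated per
    coordinate so that dimensions can be added. *)
Lemma adherent_dim n m x y : (n <= m)%nat -> adherent n x y ->
  (cell_dim m y <= cell_dim n x)%nat /\
  ((adherent n x y /\ adherent n y x) \/ (cell_dim m y < cell_dim n x)%nat).
Proof.
  intros Hnm H.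
  assert (D0 : forall n x, dyadic n x -> cell_dim n x = 0%nat).
  { intros i z Hz; unfold cell_dim, interval_dim; destruct Req_EM_T; auto.
    destruct (cell_width_dyadic i z); tauto. }
  assert (D1 : forall n x, ~ dyadic n x -> cell_dim n x = 1%nat).
  { intros i z Hz; unfold cell_dim, interval_dim; destruct Req_EM_T; auto.
    pose proof (Rinv_0_lt_compat _ (pow2_pos i)).
    destruct (cell_width_dyadic i z); [tauto | lra]. }
  destruct (classic (dyadic n x)) as [Dx|Dx].
  - rewrite <- (adherent_dyadic n x y Dx H).
    rewrite (D0 n x), (D0 m x); auto; [|now apply dyadic_le with n].
    split; auto. left; split; apply adherent_refl.
  - rewrite (D1 n x Dx).
    assert (B : (cell_dim m y <= 1)%nat).
    { destruct (classic (dyadic m y)); [rewrite D0 | rewrite D1]; auto. }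
    split; auto. destruct (classic (dyadic n y)) as [Dy|Dy].
    + right; rewrite (D0 m y); auto. now apply dyadic_le with n.
    + left; split; auto.
      apply adherent_sym_interval; split; [now apply adherent_interval|]; right.
      pose proof H as H0; apply adherent_interval in H0.
      destruct (cell_width_dyadic n x) as [[_ E]|[E _]]; [tauto|].
      assert (N1 : y <> cell_lo n x).
      { intros Ey; apply Dy; exists (Int_part (x * 2 ^ n)); rewrite Ey; unfold cell_lo.
        field. apply Rgt_not_eq, pow2_pos. }
      assert (N2 : y <> cell_lo n x + cell_width n x).
      { intros Ey; apply Dy; exists (Int_part (x * 2 ^ n) + 1)%Z.
        rewrite Ey, E, plus_IZR; unfold cell_lo.
        field. apply Rgt_not_eq, pow2_pos. }
      lra.
Qed.

(** Even [i] give the grid points and odd [i] the midpoints of the gaps: one representative for each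
    cell of level [n]. *)
Definition grid_rep (n : nat) (i : Z) : R := IZR i / (2 * 2 ^ n).

Lemma grid_rep_exists n x : exists i : Z,
  (adherent n (grid_rep n i) x /\ adherent n x (grid_rep n i)) /\
  2 * (x * 2 ^ n) - 2 <= IZR i <= 2 * (x * 2 ^ n) + 1.
Proof.
  pose proof (pow2_pos n); pose proof (int_part_spec (x * 2 ^ n)) as Hx.
  set (k := Int_part (x * 2 ^ n)) in *.
  destruct (Req_dec (x * 2 ^ n) (IZR k)) as [E|E].
  - exists (2 * k)%Z; rewrite mult_IZR.
    replace (grid_rep n (2 * k)) with x.
    + split; [split; apply adherent_refl | lra].
    + unfold grid_rep; rewrite mult_IZR, <- E; field; lra.
  - exists (2 * k + 1)%Z; rewrite plus_IZR, mult_IZR.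
    assert (G : grid_rep n (2 * k + 1) * 2 ^ n = IZR k + 1 / 2).
    { unfold grid_rep; rewrite plus_IZR, mult_IZR; field; lra. }
    split; [split|lra]; apply (adherent_gap n _ _ k); lra.
Qed.

Lemma grid_cover n B : exists l : list R, forall x, Rabs x <= B ->
  exists y, In y l /\ adherent n y x /\ adherent n x y.
Proof.
  destruct (nfloor_ex (Rabs (2 * (B * 2 ^ n) + 2))) as (N0 & _ & HN); [apply Rabs_pos|].
  set (N := S N0).
  assert (HN' : 2 * (B * 2 ^ n) + 2 <= IZR (Z.of_nat N)).
  { rewrite <- INR_IZR_INZ; unfold N; rewrite S_INR.
    pose proof (Rle_abs (2 * (B * 2 ^ n) + 2)); lra. }
  (* The indices run from [-N] to [N]. *)
  exists (map (fun j => grid_rep n (Z.of_nat j - Z.of_nat N)) (seq 0 (2 * N + 1))).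
  intros x Hx; destruct (grid_rep_exists n x) as (i & Hi & Bi).
  exists (grid_rep n i); split; auto.
  assert (Hx' : Rabs (x * 2 ^ n) <= B * 2 ^ n).
  { rewrite Rabs_mult, (Rabs_pos_eq (2 ^ n)) by (left; apply pow2_pos).
    apply Rmult_le_compat_r; auto; left; apply pow2_pos. }
  apply Rabs_le_between in Hx'.
  assert (I1 : (i <= Z.of_nat N)%Z) by (apply le_IZR; lra).
  assert (I2 : (- Z.of_nat N <= i)%Z) by (apply le_IZR; rewrite opp_IZR; lra).
  apply in_map_iff; exists (Z.to_nat (i + Z.of_nat N)); split.
  - f_equal; lia.
  - apply in_seq; lia.
Qed.

(** * Grid cells in the plane *)

Definition adherent2 (n : nat) (p q : pt) : Prop :=
  adherent n (fst p) (fst q) /\ adherent n (snd p) (snd q).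

Definition grid_cell (n : nat) (p q : pt) : Prop := adherent2 n p q /\ adherent2 n q p.

Definition grid_dim (n : nat) (p : pt) : nat := (cell_dim n (fst p) + cell_dim n (snd p))%nat.

Lemma adherent2_refl n p : adherent2 n p p.
Proof. split; apply adherent_refl. Qed.

Lemma adherent2_trans n p q r : adherent2 n p q -> adherent2 n q r -> adherent2 n p r.
Proof. intros [] []; split; eapply adherent_trans; eauto. Qed.

Lemma adherent2_le n m p q : (n <= m)%nat -> adherent2 m p q -> adherent2 n p q.
Proof. intros H []; split; eapply adherent_le; eauto. Qed.

Lemma adherent2_box n p q : adherent2 n p q <->
  box (cell_lo n (fst p)) (cell_width n (fst p)) (cell_lo n (snd p)) (cell_width n (snd p)) q.
Proof. unfold adherent2, box; now rewrite !adherent_interval. Qed.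

Lemma grid_cell_refl n p : grid_cell n p p.
Proof. split; apply adherent2_refl. Qed.

(** Leibniz equality, by extensionality, so that cells can be rewritten and found in lists. *)
Lemma grid_cell_eq n p q : grid_cell n p q -> grid_cell n p = grid_cell n q.
Proof.
  intros [H1 H2]; apply functional_extensionality; intros z.
  apply propositional_extensionality; split; intros [Z1 Z2]; split;
    eapply adherent2_trans; eauto.
Qed.

Lemma grid_cell_box n p : grid_cell n p =
  box_cell (cell_lo n (fst p)) (cell_width n (fst p)) (cell_lo n (snd p)) (cell_width n (snd p)).
Proof.
  apply functional_extensionality; intros q; apply propositional_extensionality.
  unfold grid_cell, adherent2, box_cell; rewrite <- !adherent_sym_interval; tauto.
Qed.

Lemma is_ncell_grid_cell n p : is_ncell (grid_dim n p) (grid_cell n p).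
Proof. rewrite grid_cell_box; apply is_ncell_box_cell; apply cell_width_nonneg. Qed.

(** Off the open cell at least one coordinate is an end of its gap and loses its dimension, while
    the other coordinate gains none, even when measured on the finer grid [m]. *)
Lemma adherent2_dim n m p q : (n <= m)%nat -> adherent2 n p q -> ~ grid_cell n p q ->
  (grid_dim m q < grid_dim n p)%nat.
Proof.
  intros Hnm [H1 H2] N.
  destruct (adherent_dim n m _ _ Hnm H1) as [A1 A2], (adherent_dim n m _ _ Hnm H2) as [B1 B2].
  unfold grid_dim; destruct A2 as [A2|]; [|lia]; destruct B2 as [B2|]; [|lia].
  exfalso; apply N; split; split; tauto.
Qed.

Lemma grid_cell_closure X n p q : closure_in X (grid_cell n p) q -> adherent2 n p q.
Proof.
  intros [_ H]; apply adherent2_box.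
  assert (C : forall eps, eps > 0 -> exists r, edist q r < eps /\
    box (cell_lo n (fst p)) (cell_width n (fst p)) (cell_lo n (snd p)) (cell_width n (snd p)) r).
  { intros eps He; destruct (H eps He) as (r & [Hr _] & D); exists r; split; auto.
    now apply adherent2_box. }
  revert C; clear H.
  generalize (cell_lo n (fst p)) (cell_width n (fst p)) (cell_lo n (snd p)) (cell_width n (snd p)).
  (* If a coordinate of [q] overshot the box, the overshoot itself would be a radius within which no
     point of the box lies. *)
  intros a s b t C; split; split; apply Rnot_lt_le; intros L;
  [destruct (C (a - fst q)) as (r & D & [R1 R2]) | destruct (C (fst q - (a + s))) as (r & D & [R1 R2])
  |destruct (C (b - snd q)) as (r & D & [R1 R2]) | destruct (C (snd q - (b + t))) as (r & D & [R1 R2])];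
  try lra; pose proof (edist_fst q r) as F; pose proof (edist_snd q r) as G;
  apply Rabs_le_between in F; apply Rabs_le_between in G; lra.
Qed.

(** Closure finiteness and the weak topology both come down to this count, once the level is
    bounded. *)
Lemma grid_cells_finite n0 B : exists L : list (pt -> Prop), forall n p,
  (n <= n0)%nat -> Rabs (fst p) <= B -> Rabs (snd p) <= B -> In (grid_cell n p) L.
Proof.
  assert (One : forall n, exists L : list (pt -> Prop), forall p,
            Rabs (fst p) <= B -> Rabs (snd p) <= B -> In (grid_cell n p) L).
  { intros n; destruct (grid_cover n B) as (l & Hl).
    exists (map (grid_cell n) (list_prod l l)); intros p H1 H2.
    destruct (Hl _ H1) as (x & Ix & X1 & X2), (Hl _ H2) as (y & Iy & Y1 & Y2).
    apply in_map_iff; exists (x, y); split; [|now apply in_prod].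
    apply grid_cell_eq; split; split; auto. }
  induction n0 as [|n0 (L & HL)].
  - destruct (One 0%nat) as (L & HL); exists L; intros n p Hn.
    replace n with 0%nat by lia; apply HL.
  - destruct (One (S n0)) as (L' & HL'); exists (L' ++ L); intros n p Hn H1 H2.
    apply in_or_app; destruct (le_lt_dec n n0); [right; now apply HL|left].
    replace n with (S n0) by lia; now apply HL'.
Qed.

(* The constant 3 makes [roomy_succ] work: passing to the next level shrinks
   the required margin enough to absorb a move inside the closed cell. *)
Definition roomy (Y : pt -> Prop) (n : nat) (p : pt) : Prop :=
  forall w z, adherent2 n w p -> Rabs (fst w - fst z) <= 3 * / 2 ^ n ->
    Rabs (snd w - snd z) <= 3 * / 2 ^ n -> Y z.

Definition level (Y : pt -> Prop) (n : nat) (p : pt) : Prop :=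
  roomy Y n p /\ forall m, (m < n)%nat -> ~ roomy Y m p.

(** Cell size is tied to the distance from the complement, as in the Whitney decomposition of an
    open set. *)
Definition whitney_cells (Y : pt -> Prop) (e : pt -> Prop) : Prop :=
  exists n p, level Y n p /\ e = grid_cell n p.

(** Every cell with [p] in its closure also has [q] in its closure, so the demands at [p] are among
    those at [q]. Thus the level cannot drop on passing to the boundary. *)
Lemma roomy_adherent Y n p q : adherent2 n p q -> roomy Y n q -> roomy Y n p.
Proof.
  intros H R w z Hw; apply R. now apply adherent2_trans with p.
Qed.

(** With [h = 1 / 2^n] the distances from [p] to [q], [q] to [w] and [w] to [z] are at most [h],
    [h / 2] and [3 h / 2], in total [3 h]. A margin factor [c] has to satisfy [1 + 1/2 + c/2 <= c],
    and 3 is the least such. *)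
Lemma roomy_succ Y n p q : adherent2 n p q -> roomy Y n p -> roomy Y (S n) q.
Proof.
  intros [H1 H2] R w z [W1 W2] Z1 Z2.
  apply adherent_dist in H1; apply adherent_dist in H2.
  apply adherent_dist in W1; apply adherent_dist in W2.
  apply (R p); [apply adherent2_refl| |];
    simpl in *; rewrite Rinv_mult in *; pose proof (Rinv_0_lt_compat _ (pow2_pos n));
    apply Rabs_le; apply Rabs_le_between in H1; apply Rabs_le_between in H2;
    apply Rabs_le_between in W1; apply Rabs_le_between in W2;
    apply Rabs_le_between in Z1; apply Rabs_le_between in Z2; lra.
Qed.

Lemma roomy_subset Y n p q : roomy Y n p -> adherent2 n p q -> Y q.
Proof.
  intros R [H1 H2]; pose proof (Rinv_0_lt_compat _ (pow2_pos n)).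
  apply adherent_dist in H1; apply adherent_dist in H2.
  apply (R p); [apply adherent2_refl | lra | lra].
Qed.

Lemma roomy_level Y n p : roomy Y n p -> exists m, (m <= n)%nat /\ level Y m p.
Proof.
  induction n as [n IH] using (well_founded_induction lt_wf); intros R.
  destruct (classic (exists m, (m < n)%nat /\ roomy Y m p)) as [(m & Hm & Rm)|N].
  - destruct (IH m Hm Rm) as (k & Hk & L); exists k; split; auto; lia.
  - exists n; split; auto; split; auto. intros m Hm Rm; apply N; now exists m.
Qed.

Lemma level_unique Y n m p : level Y n p -> level Y m p -> n = m.
Proof.
  intros [R1 N1] [R2 N2]; destruct (lt_eq_lt_dec n m) as [[H|]|H]; auto; exfalso.
  - now apply (N2 n).
  - now apply (N1 m).
Qed.

(** [roomy_succ] bounds the level at [q] from above; a coarser roomy level at [q] would by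
    [roomy_adherent] be roomy at [p], against minimality of [n]. *)
Lemma level_adherent Y n p q : level Y n p -> adherent2 n p q ->
  exists m, (n <= m <= S n)%nat /\ level Y m q.
Proof.
  intros [R N] H; destruct (roomy_level Y (S n) q) as (m & Hm & L).
  { now apply roomy_succ with p. }
  exists m; split; auto; split; auto. apply Nat.nlt_ge; intros D.
  apply (N m D), roomy_adherent with q; [|apply L].
  apply adherent2_le with n; auto; lia.
Qed.

Lemma level_grid_cell Y n p q : level Y n p -> grid_cell n p q -> level Y n q.
Proof.
  intros [R N] [H1 H2]; split.
  - now apply roomy_adherent with p.
  - intros m Hm Rm; apply (N m Hm), roomy_adherent with q; auto.
    apply adherent2_le with n; auto; lia.
Qed.

Lemma inv_pow2_small eps : 0 < eps -> exists n, / 2 ^ n < eps.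
Proof.
  intros He; destruct (pow_lt_1_zero (/ 2)) with (y := eps) as (n & Hn); auto.
  { rewrite Rabs_pos_eq; lra. }
  exists n; specialize (Hn n (le_n n)). rewrite pow_inv, Rabs_pos_eq in Hn; auto.
  left; apply Rinv_0_lt_compat, pow2_pos.
Qed.

Lemma roomy_near Y p : open2 Y -> Y p -> exists n r, 0 < r /\
  forall q, edist p q < r -> roomy Y n q.
Proof.
  intros HY Hp; destruct (HY p Hp) as (r & Hr & B).
  (* In each coordinate [q] is off by less than [r / 4], [w] by [r / 16] and [z] by [3 r / 16], in
     sum [r / 2]; the two coordinates together stay below [r]. *)
  destruct (inv_pow2_small (r / 16)) as (n & Hn); [lra|].
  exists n, (r / 4); split; [lra|]; intros q Hq w z [W1 W2] Z1 Z2.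
  apply adherent_dist in W1; apply adherent_dist in W2.
  apply B; eapply Rle_lt_trans; [apply edist_le_sum|].
  pose proof (edist_fst p q) as F; pose proof (edist_snd p q) as G.
  apply Rabs_le_between in F; apply Rabs_le_between in G.
  apply Rabs_le_between in W1; apply Rabs_le_between in W2.
  apply Rabs_le_between in Z1; apply Rabs_le_between in Z2.
  assert (Rabs (fst p - fst z) < r / 2) by (apply Rabs_def1; lra).
  assert (Rabs (snd p - snd z) < r / 2) by (apply Rabs_def1; lra).
  lra.
Qed.

Lemma level_exists Y p : open2 Y -> Y p -> exists n, level Y n p.
Proof.
  intros HY Hp; destruct (roomy_near Y p HY Hp) as (n & r & Hr & R).
  destruct (roomy_level Y n p) as (m & _ & L); [|now exists m].
  apply R; now rewrite edist_refl.
Qed.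

(** * The axioms of a cell decomposition and of a CW complex *)

Lemma whitney_cells_countable Y : exists enum : nat -> pt -> Prop,
  forall e, whitney_cells Y e -> exists k, forall p, e p <-> enum k p.
Proof.
  set (z := fun k : nat => let (a, b) := Cantor.of_nat k in (Z.of_nat a - Z.of_nat b)%Z).
  assert (Hz : forall i, exists k, z k = i).
  { intros i; exists (Cantor.to_nat (Z.to_nat i, Z.to_nat (- i))).
    unfold z; rewrite Cantor.cancel_of_to; lia. }
  (* All cells of all grids are enumerated; those of the decomposition are among them. *)
  exists (fun k => let (n, r) := Cantor.of_nat k in let (u, v) := Cantor.of_nat r in
            grid_cell n (grid_rep n (z u), grid_rep n (z v))).
  intros e (n & p & _ & ->).
  destruct (grid_rep_exists n (fst p)) as (i & [I1 I2] & _).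
  destruct (grid_rep_exists n (snd p)) as (j & [J1 J2] & _).
  destruct (Hz i) as (u & Hu), (Hz j) as (v & Hv).
  exists (Cantor.to_nat (n, Cantor.to_nat (u, v))); intros q.
  rewrite !Cantor.cancel_of_to, Hu, Hv.
  rewrite (grid_cell_eq n p (grid_rep n i, grid_rep n j)); [tauto|].
  split; split; auto.
Qed.

Lemma whitney_cell_decomposition Y : open2 Y -> cell_decomposition Y (whitney_cells Y).
Proof.
  intros HY; split; [apply whitney_cells_countable|]; split; [|split].
  - intros e (n & p & _ & ->); eexists; apply is_ncell_grid_cell.
  - intros e e' (n & p & L & ->) (m & q & M & ->) (r & R1 & R2).
    pose proof (level_grid_cell _ _ _ _ L R1) as L'.
    pose proof (level_grid_cell _ _ _ _ M R2) as M'.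
    rewrite (level_unique _ _ _ _ L' M') in *.
    rewrite (grid_cell_eq m p r R1), (grid_cell_eq m q r R2); tauto.
  - intros p; split.
    + intros Hp; destruct (level_exists Y p HY Hp) as (n & L).
      exists (grid_cell n p); split; [now exists n, p | apply grid_cell_refl].
    + intros (e & (n & q & [R _] & ->) & [H _]); now apply roomy_subset with n q.
Qed.

(** A cell that meets the closure has level at most [S n] and contains a point within [1 / 2^n] of
    [p] in each coordinate. *)
Lemma whitney_closure_finite Y e : whitney_cells Y e -> exists L : list (pt -> Prop),
  forall e', whitney_cells Y e' -> (exists p, closure_in Y e p /\ e' p) ->
    exists e'', In e'' L /\ forall p, e' p <-> e'' p.
Proof.
  intros (n & p & Lp & ->).
  destruct (grid_cells_finite (S n) (Rabs (fst p) + Rabs (snd p) + / 2 ^ n)) as (L & HL).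
  exists L; intros e' (m & q & Lq & ->) (r & Hr & Qr).
  exists (grid_cell m q); split; [|tauto].
  apply grid_cell_closure in Hr.
  destruct (level_adherent Y n p r Lp Hr) as (k & Hk & Lr).
  pose proof (level_unique _ _ _ _ (level_grid_cell _ _ _ _ Lq Qr) Lr); subst k.
  rewrite (grid_cell_eq m q r Qr); destruct Hr as [R1 R2].
  apply adherent_dist in R1; apply adherent_dist in R2.
  pose proof (Rabs_pos (fst p)); pose proof (Rabs_pos (snd p)).
  pose proof (Rabs_triang_inv (fst r) (fst p)); pose proof (Rabs_triang_inv (snd r) (snd p)).
  rewrite (Rabs_minus_sym (fst r)), (Rabs_minus_sym (snd r)) in *.
  apply HL; [lia | lra | lra].
Qed.

(** Local finiteness: the level is bounded near [p], so only finitely many cells come close, and the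
    least of finitely many radii separates [p] from [S]. *)
Lemma whitney_weak_topology Y S : open2 Y -> (forall p, S p -> Y p) ->
  (forall e, whitney_cells Y e ->
     closed_in (closure_in Y e) (fun p => S p /\ closure_in Y e p)) ->
  closed_in Y S.
Proof.
  intros HY SY HS p [Yp Cp]; apply NNPP; intros Np.
  assert (Sep : forall L : list (pt -> Prop), exists eps, 0 < eps /\
    forall e, In e L -> whitney_cells Y e -> forall q, S q -> e q -> edist p q < eps -> False).
  { induction L as [|e L (eps & He & IH)]; [exists 1; split; [lra | intros ? []]|].
    (* Without such a radius [p] would be a limit of points of [S] in [e], and closedness of [S] in
       the closure of [e] would put [p] into [S]. *)
    assert (exists eps, 0 < eps /\
      (whitney_cells Y e -> forall q, S q -> e q -> edist p q < eps -> False)) as (d & Hd & D).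
    { apply NNPP; intros N.
      assert (A : forall eps, eps > 0 -> whitney_cells Y e /\
                exists q, S q /\ e q /\ edist p q < eps).
      { intros d Hd; split; apply NNPP; intros N'; apply N; exists d; split; auto.
        intros _ q Sq eq dq; apply N'; now exists q. }
      assert (We : whitney_cells Y e) by (apply (A 1); lra).
      assert (Ce : closure_in Y e p).
      { split; auto; intros d Hd; destruct (A d Hd) as (_ & q & _ & eq & dq); now exists q. }
      apply Np, (HS e We); split; auto.
      intros d Hd; destruct (A d Hd) as (_ & q & Sq & eq & dq); exists q; repeat split; auto.
      intros d' Hd'; exists q; split; auto; now rewrite edist_refl. }
    exists (Rmin eps d); split; [now apply Rmin_glb_lt|].
    pose proof (Rmin_l eps d); pose proof (Rmin_r eps d).
    intros e' [<-|He'] W q Sq eq dq; [apply (D W q) | apply (IH e' He' W q)]; auto; lra. }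
  destruct (roomy_near Y p HY Yp) as (n & r & Hr & R).
  destruct (grid_cells_finite n (Rabs (fst p) + Rabs (snd p) + r)) as (L & HL).
  destruct (Sep L) as (eps & He & HSep).
  destruct (Cp (Rmin eps r)) as (q & Sq & Hq); [now apply Rmin_glb_lt|].
  pose proof (Rmin_l eps r); pose proof (Rmin_r eps r).
  destruct (roomy_level Y n q) as (m & Hm & Lq); [apply R; lra|].
  apply (HSep (grid_cell m q)) with q; auto.
  - pose proof (edist_fst p q); pose proof (edist_snd p q).
    pose proof (Rabs_pos (fst p)); pose proof (Rabs_pos (snd p)).
    pose proof (Rabs_triang_inv (fst q) (fst p)); pose proof (Rabs_triang_inv (snd q) (snd p)).
    rewrite (Rabs_minus_sym (fst q)), (Rabs_minus_sym (snd q)) in *.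
    apply HL; [lia | lra | lra].
  - now exists m, q.
  - apply grid_cell_refl.
  - lra.
Qed.

Lemma whitney_CW_complex Y : open2 Y -> CW_complex Y (whitney_cells Y).
Proof.
  intros HY; split; [|split].
  - intros e k (n & p & Lp & ->) Hk.
    rewrite (is_ncell_dim_unique _ _ _ Hk (is_ncell_grid_cell n p)) in *; clear k Hk.
    destruct (box_characteristic_map (cell_lo n (fst p)) (cell_width n (fst p))
                (cell_lo n (snd p)) (cell_width n (snd p)))
      as (Phi & psi & C1 & C2 & C3 & C4 & C5 & C6); try apply cell_width_nonneg.
    rewrite <- grid_cell_box in *.
    assert (A : forall q, closed_model (grid_dim n p) q -> adherent2 n p (Phi q))
      by (intros; now apply adherent2_box, C2).
    exists Phi, psi; repeat apply conj; auto.
    + intros q Hq; apply roomy_subset with n p; [apply Lp | now apply A].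
    + intros q Hq N.
      (* A boundary point belongs to a cell of the same or the next level; [adherent2_dim] compares
         dimensions across the two grids. *)
      destruct (level_adherent Y n p (Phi q) Lp (A q Hq)) as (m & Hm & L).
      exists (grid_cell m (Phi q)), (grid_dim m (Phi q)); split; [now exists m, (Phi q)|].
      split; [apply is_ncell_grid_cell|]; split; [|apply grid_cell_refl].
      apply adherent2_dim; [lia | now apply A | now apply C6].
  - apply whitney_closure_finite.
  - intros S SY; now apply whitney_weak_topology.
Qed.

(** * Openness of unions of basic sets *)

Lemma poly2_continuous f x y : is_poly2 f -> continuity_2d_pt f x y.
Proof.
  intros (l & Hl); apply continuity_2d_pt_ext with (eval_monos l); [now intros|].
  clear Hl; induction l as [|[[i j] c] l IH]; simpl.
  - apply continuity_2d_pt_const.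
  - apply continuity_2d_pt_plus; auto.
    repeat apply continuity_2d_pt_mult; try apply continuity_2d_pt_const;
      apply continuity_2d_pt_pow; [apply continuity_2d_pt_id1 | apply continuity_2d_pt_id2].
Qed.

Lemma basic_open_set (gs : list (R -> R -> R)) : (forall g, In g gs -> is_poly2 g) ->
  open2 (fun p => forall g, In g gs -> g (fst p) (snd p) > 0).
Proof.
  induction gs as [|g gs IH]; intros Hg p Hp.
  - exists 1; split; [lra | intros q _ h []].
  - destruct (IH (fun h H => Hg h (or_intror H)) p (fun h H => Hp h (or_intror H))) as (e & He & B).
    pose proof (Hp g (or_introl eq_refl)) as Pg.
    (* The positive value of [g] at [p] serves as the tolerance, so [g] stays positive nearby. *)
    destruct (poly2_continuous g (fst p) (snd p) (Hg g (or_introl eq_refl)) (mkposreal _ Pg))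
      as (d & D).
    exists (Rmin e d); split; [apply Rmin_glb_lt; [auto | apply cond_pos]|].
    pose proof (Rmin_l e d); pose proof (Rmin_r e d).
    intros q Hq h [<-|Hh]; [|apply B; auto; lra].
    pose proof (edist_fst q p); pose proof (edist_snd q p); rewrite (edist_sym q p) in *.
    specialize (D (fst q) (snd q) ltac:(lra) ltac:(lra)); simpl in D.
    apply Rabs_def2 in D; lra.
Qed.

Lemma union_of_basic_open Ys :
  (forall blk, In blk Ys -> forall g, In g blk -> is_poly2 g) -> open2 (union_of_basic Ys).
Proof.
  intros H p (blk & Hb & Hp).
  destruct (basic_open_set blk (H blk Hb) p Hp) as (e & He & B).
  exists e; split; auto; intros q Hq; exists blk; split; auto.
Qed.

Theorem theorem3p5 (Ys : list (list (R -> R -> R))) :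
  (forall blk, In blk Ys -> blk <> nil /\ forall g, In g blk -> irreducible2 g) ->
  exists cA : (pt -> Prop) -> Prop,
    cell_decomposition (union_of_basic Ys) cA /\
    CW_complex (union_of_basic Ys) cA /\
    finiteness_property (union_of_basic Ys) cA.
Proof.
  intros H.
  assert (HY : open2 (union_of_basic Ys)).
  { apply union_of_basic_open; intros blk Hb g Hg; now apply H with blk. }
  exists (whitney_cells (union_of_basic Ys)); split; [|split].
  - now apply whitney_cell_decomposition.
  - now apply whitney_CW_complex.
  - apply finiteness_property_convex; auto.
    intros e (n & p & _ & ->); rewrite grid_cell_box; apply box_cell_convex.
Qed.
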